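(* Let $\beta\in \mathrm{Sym}_n(\mathbb Q)$ be positive semi-definite of rank $n-1$. Then $\Gamma$ acts with finitely many orbits on the set of reduced elements of $\Omega_\beta^s\cap(L^n+h)$, and the (union over $i,j$ of the) sets $\mathcal C_{\beta,i,j}^{red}=\mathcal C_{\beta,i,j}\cap\Omega_\beta^{red}$ form a set of representatives for these orbits.
   Context: $V$ is a $\mathbb Q$-vector space of dimension $p+1$ with a non-degenerate symmetric bilinear form $(\,,)$ of signature $(p,1)$; $L\subset V$ is a $\mathbb Z$-lattice of full rank with $L\subset L^{\#}$ (dual lattice); $1\le n\le p$, $h\in(L^{\#})^n$. $B$ is one component of $\{Z\in V(\mathbb R):(Z,Z)=-1\}$. $G_0(\mathbb R)$ is the identity component of $SO(V)(\mathbb R)$ and $\Gamma$ is a neat subgroup of finite index in the stabilizer of $L$ in $G_0(\mathbb R)$, acting trivially on $L^{\#}/L$; $V$ has nonzero rational isotropic vectors. $\ell_0,\dots,\ell_r$ represent the $\Gamma$-orbits of rational isotropic lines; $\Gamma_j=\Gamma\cap N_j$, where $N_j$ is the unipotent radical of the parabolic subgroup stabilizing $\ell_j$. For $X\in V^n$, $(X,X)=((x_i,x_j))$ and $R(X)$ is the radical of $\mathrm{span}(X)$. $\Omega_\beta^s=\{X\in V^n:\frac12(X,X)=\beta,\ \mathrm{rank}(X)=n\}$. For $X\in\Omega_\beta^s$, $R(X)=\ell_X$ is a rational isotropic line; let $u_X$ be the primitive generator of $\ell_X\cap L$ with $(u_X,Z)<0$ for all $Z\in B$. $X$ is called reduced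 if for one of the two primitive vectors $a\in\mathbb Z^n$ with $\beta a=0$ one has $X\cdot a=\nu(X)u_X$ with $\nu(X)\in[0,1)$ (here $X\cdot a=\sum a_ix_i$); $\Omega_\beta^{red}\subset\Omega_\beta^s$ is the set of reduced elements. Let $\{U_{ij}\}_{i=1}^{a_j}$ be the finite set of subspaces $\mathrm{span}(X)$ with $X\in\Omega_\beta^s\cap(L^n+h)$, $\ell_X=\ell_j$; let $\Omega_{\beta,i,j}=\{X\in\Omega_\beta^s:\mathrm{span}(X)=U_{ij}\}$ and let $\Gamma_{U_{ij}}$ be the subgroup of $\Gamma_j$ acting trivially on $U_{ij}$. $\Gamma_j/\Gamma_{U_{ij}}$ acts freely on $\Omega_{\beta,i,j}\cap(L^n+h)$, and $\mathcal C_{\beta,i,j}$ is a set of orbit representatives for this action. *)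

(* Defs.v *)
From mathcomp Require Import all_boot all_order all_algebra all_field.
From mathcomp Require Import all_classical all_reals all_analysis.

Set Implicit Arguments.
Unset Strict Implicit.
Unset Printing Implicit Defensive.

Import Order.TTheory GRing.Theory Num.Theory.
Import numFieldNormedType.Exports.

Local Open Scope classical_set_scope.
Local Open Scope ring_scope.

(* A basis of V is fixed: V = Q^m (column vectors) with Gram matrix A, and
   V(K) = K^m for a field extension K of Q.  An n-tuple X of vectors is the
   m x n matrix whose columns are the x_i, so that the Gram matrix (X, Y) is
   X^T A Y, X . a is X *m a, and a linear map g acts on V^n by g *m X. *)

Definition ext (K : unitRingType) (m n : nat) (M : 'M[rat]_(m, n)) :
  'M[K]_(m, n) := map_mx ratr M.

Definition gram (K : fieldType) (m n k : nat) (A : 'M[K]_m)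
  (X : 'M[K]_(m, n)) (Y : 'M[K]_(m, k)) : 'M[K]_(n, k) := X^T *m A *m Y.

Definition bform (K : fieldType) (m : nat) (A : 'M[K]_m) (x y : 'cV[K]_m) : K :=
  gram A x y 0 0.

Definition has_signature_p1 (R : realType) (p : nat) (A : 'M[R]_p.+1) : Prop :=
  exists2 P : 'M[R]_p.+1, P \in unitmx &
    gram A P P = diag_mx (\row_i (if i == ord_max then -1 else 1)).

Definition int_mx (m n : nat) (c : 'M[int]_(m, n)) : 'M[rat]_(m, n) :=
  map_mx intr c.

Definition full_lattice (m : nat) (L : set 'cV[rat]_m) : Prop :=
  exists2 E : 'M[rat]_m, E \in unitmx &
    L = range (fun c : 'cV[int]_m => E *m int_mx c).

Definition dual_lattice (m : nat) (A : 'M[rat]_m) (L : set 'cV[rat]_m) :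
  set 'cV[rat]_m :=
  [set x | forall y, L y -> bform A x y \is a Num.int].

Definition in_power (m n : nat) (L : set 'cV[rat]_m) : set 'M[rat]_(m, n) :=
  [set X | forall i, L (col i X)].

Definition coset_power (m n : nat) (L : set 'cV[rat]_m) (h : 'M[rat]_(m, n)) :
  set 'M[rat]_(m, n) :=
  [set X | in_power L (X - h)].

Definition subgroup (K : fieldType) (m : nat) (G : set 'M[K]_m) : Prop :=
  [/\ G `<=` [set g | g \in unitmx], G 1%:M,
      forall g h, G g -> G h -> G (g *m h) &
      forall g, G g -> G (invmx g)].

Definition left_cosets (K : fieldType) (m : nat) (G H : set 'M[K]_m) :
  set (set 'M[K]_m) :=
  [set (fun h => g *m h) @` H | g in G].

Definition SO (K : fieldType) (m : nat) (A : 'M[K]_m) : set 'M[K]_m :=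
  [set g | gram A g g = A /\ \det g = 1].

Definition SO_id (R : realType) (m : nat) (A : 'M[R]_m) : set 'M[R]_m :=
  connected_component (SO A) 1%:M.

(* An element of the real group preserving the full lattice L is rational, so
   the stabilizer of L in the identity component is a set of rational
   matrices. *)
Definition lattice_stab (R : realType) (m : nat) (A : 'M[rat]_m)
  (L : set 'cV[rat]_m) : set 'M[rat]_m :=
  [set g | SO_id (ext R A) (ext R g) /\ mulmx g @` L = L].

Inductive eigenvalue_group (m : nat) (g : 'M[rat]_m) : algC -> Prop :=
| EigGen z of eigenvalue (ext algC g) z : eigenvalue_group g z
| EigOne : eigenvalue_group g 1
| EigDiv z w of eigenvalue_group g z & eigenvalue_group g w :
    eigenvalue_group g (z / w).

Definition neat (m : nat) (G : set 'M[rat]_m) : Prop :=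
  forall g, G g -> forall z, eigenvalue_group g z ->
  forall k : nat, (0 < k)%N -> z ^+ k = 1 -> z = 1.

Definition hyperboloid (R : realType) (m : nat) (A : 'M[rat]_m) :
  set 'cV[R]_m :=
  [set Z | bform (ext R A) Z Z = -1].

Definition hyperboloid_component (R : realType) (m : nat) (A : 'M[rat]_m)
  (B : set 'cV[R]_m) : Prop :=
  exists2 Z : 'cV[R]_m, hyperboloid A Z &
    B = connected_component (hyperboloid A) Z.

Definition isotropic_line (m : nat) (A : 'M[rat]_m) : set (set 'cV[rat]_m) :=
  [set l | exists u, [/\ u != 0, bform A u u = 0 &
                      l = range (fun c : rat => c *: u)]].

Definition represents (T : Type) (e : T -> T -> Prop) (S C : set T) : Prop :=
  C `<=` S /\ forall x, S x -> exists! y, C y /\ e y x.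

Definition same_orbit (m n : nat) (G : set 'M[rat]_m) (Y X : 'M[rat]_(m, n)) :
  Prop :=
  exists2 g, G g & Y = g *m X.

Definition orbit_of (m n : nat) (G : set 'M[rat]_m) (X : 'M[rat]_(m, n)) :
  set 'M[rat]_(m, n) :=
  [set Y | same_orbit G Y X].

Definition same_line_orbit (m : nat) (G : set 'M[rat]_m)
  (l' l : set 'cV[rat]_m) : Prop :=
  exists2 g, G g & l' = mulmx g @` l.

Definition line_stab (m : nat) (A : 'M[rat]_m) (l : set 'cV[rat]_m) :
  set 'M[rat]_m :=
  [set g | SO A g /\ mulmx g @` l = l].

Definition unipotent (m : nat) (g : 'M[rat]_m) : Prop :=
  exists k : nat, iter k (mulmx (g - 1%:M)) 1%:M = 0.

Definition normal_unipotent (m : nat) (P N : set 'M[rat]_m) : Prop :=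
  [/\ subgroup N, N `<=` P,
      forall g x, P g -> N x -> N (g *m x *m invmx g) &
      forall x, N x -> unipotent x].

(* The largest normal unipotent subgroup.  Applied to the rational points of a
   connected algebraic group P over Q these are the rational points of the
   unipotent radical: the rational points are Zariski dense in P, and in
   characteristic 0 a Zariski closed unipotent group is connected. *)
Definition unipotent_radical (m : nat) (P : set 'M[rat]_m) : set 'M[rat]_m :=
  \bigcup_(N in normal_unipotent P) N.

Definition cusp_group (m : nat) (A : 'M[rat]_m) (Gamma : set 'M[rat]_m)
  (l : set 'cV[rat]_m) : set 'M[rat]_m :=
  Gamma `&` unipotent_radical (line_stab A l).

Definition span_of (m n : nat) (X : 'M[rat]_(m, n)) : set 'cV[rat]_m :=
  range (fun c : 'cV[rat]_n => X *m c).

Definition radical (m : nat) (A : 'M[rat]_m) (U : set 'cV[rat]_m) :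
  set 'cV[rat]_m :=
  [set x | U x /\ forall y, U y -> bform A x y = 0].

Definition psd (n : nat) (beta : 'M[rat]_n) : Prop :=
  forall x : 'cV[rat]_n, 0 <= bform beta x x.

Definition Omega_s (m n : nat) (A : 'M[rat]_m) (beta : 'M[rat]_n) :
  set 'M[rat]_(m, n) :=
  [set X | 2^-1 *: gram A X X = beta /\ \rank X = n].

Definition is_u (R : realType) (m n : nat) (A : 'M[rat]_m)
  (L : set 'cV[rat]_m) (B : set 'cV[R]_m) (X : 'M[rat]_(m, n))
  (u : 'cV[rat]_m) : Prop :=
  radical A (span_of X) `&` L = range (fun k : int => u *~ k) /\
  forall Z, B Z -> bform (ext R A) (ext R u) Z < 0.

Definition primitive_vec (n : nat) (a : 'cV[int]_n) : Prop :=
  \big[gcdn/0%N]_(i < n) absz (a i 0%R) = 1%N.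

Definition Omega_red (R : realType) (m n : nat) (A : 'M[rat]_m)
  (L : set 'cV[rat]_m) (B : set 'cV[R]_m) (beta : 'M[rat]_n) :
  set 'M[rat]_(m, n) :=
  [set X | Omega_s A beta X /\
    exists (u : 'cV[rat]_m) (a : 'cV[int]_n) (nu : rat),
      [/\ is_u A L B X u, primitive_vec a, beta *m int_mx a = 0,
          X *m int_mx a = nu *: u & 0 <= nu < 1]].

(* The set {U_ij}_i of the subspaces attached to l = l_j. *)
Definition spans_at (m n : nat) (A : 'M[rat]_m) (L : set 'cV[rat]_m)
  (h : 'M[rat]_(m, n)) (beta : 'M[rat]_n) (l : set 'cV[rat]_m) :
  set (set 'cV[rat]_m) :=
  [set U | exists X, [/\ Omega_s A beta X, coset_power L h X,
                         radical A (span_of X) = l & U = span_of X]].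

Definition Omega_span (m n : nat) (A : 'M[rat]_m) (beta : 'M[rat]_n)
  (U : set 'cV[rat]_m) : set 'M[rat]_(m, n) :=
  [set X | Omega_s A beta X /\ span_of X = U].

Definition fixing (m : nat) (G : set 'M[rat]_m) (U : set 'cV[rat]_m) :
  set 'M[rat]_m :=
  [set g | G g /\ forall x, U x -> g *m x = x].

(* Y = (g G_U) X for a coset g G_U in G / G_U, where G_U is the subgroup of G
   fixing U pointwise and X spans U. *)
Definition same_quotient_orbit (m n : nat) (G : set 'M[rat]_m)
  (U : set 'cV[rat]_m) (Y X : 'M[rat]_(m, n)) : Prop :=
  exists2 c, left_cosets G (fixing G U) c & same_orbit c Y X.

(* Main.v *)
Require Import Defs.
From mathcomp Require Import all_boot all_order all_algebra all_field.
From mathcomp Require Import all_classical all_reals all_analysis.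
From mathcomp Require Import ring lra.

(** A reduced [X] has as radical of its span an isotropic line [Q u].  Moving it
    by [Gamma], the line becomes one of the [l j].  An element [g] of [Gamma]
    relating two tuples over the same [l j] fixes [u] (it preserves [L] and [B]),
    and has finite order on the positive definite space [u^perp / u]; by
    neatness it acts trivially there, so it lies in the unipotent radical and
    preserves every subspace between [Q u] and [u^perp].  Hence [Gamma]-orbits
    over [l j] are orbits of the cusp group.  For finiteness, the image of [X] in
    [u^perp / u] lies in a lattice and has bounded length; tuples with the same
    image differ by [u d] with [d] an integral row, and being reduced forces
    [d . a = 0] up to finitely many choices, in which case [u d] is produced by
    an Eichler transformation attached to [u]. *)

Set Implicit Arguments.
Unset Strict Implicit.
Unset Printing Implicit Defensive.

Import Order.TTheory GRing.Theory Num.Theory.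
Import numFieldNormedType.Exports.

Local Open Scope classical_set_scope.
Local Open Scope ring_scope.

(** * Bilinear forms and Gram matrices *)

Section BilinearForm.
Variables (K : fieldType) (m : nat) (A : 'M[K]_m).
Implicit Types (x y z : 'cV[K]_m) (c : K) (g : 'M[K]_m).

Lemma bformDl x y z : bform A (x + y) z = bform A x z + bform A y z.
Proof. by rewrite /bform /gram linearD !mulmxDl mxE. Qed.

Lemma bformDr x y z : bform A x (y + z) = bform A x y + bform A x z.
Proof. by rewrite /bform /gram mulmxDr mxE. Qed.

Lemma bformZl c x y : bform A (c *: x) y = c * bform A x y.
Proof. by rewrite /bform /gram linearZ -!scalemxAl mxE. Qed.

Lemma bformZr c x y : bform A x (c *: y) = c * bform A x y.
Proof. by rewrite /bform /gram -scalemxAr mxE. Qed.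

Lemma bformNl x y : bform A (- x) y = - bform A x y.
Proof. by rewrite -scaleN1r bformZl mulN1r. Qed.

Lemma bformNr x y : bform A x (- y) = - bform A x y.
Proof. by rewrite -scaleN1r bformZr mulN1r. Qed.

Lemma bform0l x : bform A 0 x = 0.
Proof. by rewrite -(scale0r 0) bformZl mul0r. Qed.

Definition bformE := (bformDl, bformDr, bformZl, bformZr, bformNl, bformNr).

Lemma gram11 x y : gram A x y = (bform A x y)%:M.
Proof. exact: mx11_scalar. Qed.

Lemma gram_mulmx n k g (X : 'M[K]_(m, n)) (Y : 'M[K]_(m, k)) :
  gram A (g *m X) (g *m Y) = gram (gram A g g) X Y.
Proof. by rewrite /gram trmx_mul !mulmxA. Qed.

Lemma bform_mulmx g x y : bform A (g *m x) (g *m y) = bform (gram A g g) x y.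
Proof. by rewrite /bform gram_mulmx. Qed.

Lemma gram_coef n k (X : 'M[K]_(m, n)) (Y : 'M[K]_(m, k)) i j :
  gram A X Y i j = bform A (col i X) (col j Y).
Proof.
rewrite !colE /bform /gram trmx_mul trmx_delta !mulmxA -!(mulmxA (delta_mx 0 i)).
by rewrite -rowE -colE !mxE.
Qed.

Lemma gram_mulr n k s (X : 'M[K]_(m, n)) (Y : 'M[K]_(m, k)) (Z : 'M[K]_(k, s)) :
  gram A X (Y *m Z) = gram A X Y *m Z.
Proof. by rewrite /gram mulmxA. Qed.

Lemma gram_mull n k s (X : 'M[K]_(m, n)) (Y : 'M[K]_(m, k)) (Z : 'M[K]_(n, s)) :
  gram A (X *m Z) Y = Z^T *m gram A X Y.
Proof. by rewrite /gram trmx_mul !mulmxA. Qed.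

Hypothesis A_sym : A^T = A.

Lemma tr_gram n k (X : 'M[K]_(m, n)) (Y : 'M[K]_(m, k)) :
  (gram A X Y)^T = gram A Y X.
Proof. by rewrite /gram !trmx_mul trmxK A_sym mulmxA. Qed.

Lemma bformC x y : bform A x y = bform A y x.
Proof. by rewrite /bform -tr_gram mxE. Qed.

End BilinearForm.

Lemma cV_delta (K : fieldType) m n (M : 'M[K]_(m, n)) j :
  M *m (delta_mx j 0 : 'cV_n) = col j M.
Proof. by rewrite colE. Qed.

Lemma mulmx_ext (K : fieldType) m n (M N : 'M[K]_(m, n)) :
  (forall x : 'cV_n, M *m x = N *m x) -> M = N.
Proof.
move=> MN; apply/matrixP => i j.
by have /matrixP/(_ i 0) := MN (delta_mx j 0); rewrite !cV_delta !mxE.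
Qed.

Lemma bform_ext (K : fieldType) m (A B : 'M[K]_m) :
  (forall x y, bform A x y = bform B x y) -> A = B.
Proof.
move=> AB; apply/matrixP => i j; have := AB (delta_mx i 0) (delta_mx j 0).
by rewrite /bform /gram !trmx_delta -!rowE -!colE !mxE.
Qed.

Lemma bform_delta (K : fieldType) m (A : 'M[K]_m) x i : A^T = A -> A \in unitmx ->
  bform A (invmx A *m delta_mx i 0) x = x i 0.
Proof.
move=> As Au; rewrite /bform /gram trmx_mul trmx_inv As -mulmxA mulmxA mulmxKV //.
by rewrite trmx_delta -rowE mxE.
Qed.

(** * Isometries and the special orthogonal group *)

Lemma isometry_unit (K : fieldType) m (A g : 'M[K]_m) :
  A \in unitmx -> gram A g g = A -> g \in unitmx.
Proof.
by move=> Au gA; move: Au; rewrite -gA /gram unitmx_mul => /andP[].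
Qed.

Lemma isometry_inv (K : fieldType) m (A g : 'M[K]_m) :
  A \in unitmx -> gram A g g = A -> gram A (invmx g) (invmx g) = A.
Proof.
move=> Au gA; have gu := isometry_unit Au gA.
by rewrite -{1}gA /gram trmx_inv !mulmxA mulVmx ?unitmx_tr // mul1mx mulmxK.
Qed.

Lemma isometry_mul (K : fieldType) m (A g f : 'M[K]_m) :
  gram A g g = A -> gram A f f = A -> gram A (g *m f) (g *m f) = A.
Proof.
by move=> gA fA; rewrite -{2}fA -{2}gA /gram trmx_mul !mulmxA.
Qed.

Lemma bform_isometry (K : fieldType) m (A g : 'M[K]_m) x y :
  gram A g g = A -> bform A (g *m x) (g *m y) = bform A x y.
Proof. by move=> gA; rewrite bform_mulmx gA. Qed.

Lemma SO_mul (K : fieldType) m (A g f : 'M[K]_m) :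
  SO A g -> SO A f -> SO A (g *m f).
Proof.
by move=> [gA dg] [fA df]; split; [exact: isometry_mul | rewrite det_mulmx dg df mulr1].
Qed.

Lemma SO_inv (K : fieldType) m (A g : 'M[K]_m) : A \in unitmx ->
  SO A g -> SO A (invmx g).
Proof.
by move=> Au [gA dg]; split; [exact: isometry_inv | rewrite det_inv dg invr1].
Qed.

(* The Eichler transformation [x |-> x + (u,x) w - (w,x) u - (w,w)/2 (u,x) u],
   an isometry for isotropic [u] orthogonal to [w]. *)
Definition eichler (K : fieldType) m (A : 'M[K]_m) (u w : 'cV[K]_m) : 'M[K]_m :=
  1%:M + w *m u^T *m A - u *m w^T *m A - (bform A w w / 2) *: (u *m u^T *m A).

(** * Group law and determinant of Eichler transformations *)

Section Eichler.
Variables (K : numFieldType) (m : nat) (A : 'M[K]_m) (u : 'cV[K]_m).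
Hypotheses (A_sym : A^T = A) (A_unit : A \in unitmx) (u_iso : bform A u u = 0).
Implicit Types (x y w : 'cV[K]_m).

Lemma outer_mulmx n x y (X : 'M[K]_(m, n)) : x *m y^T *m A *m X = x *m gram A y X.
Proof. by rewrite /gram !mulmxA. Qed.

Lemma eichlerE w x : eichler A u w *m x =
  x + bform A u x *: w - bform A w x *: u - (bform A w w / 2 * bform A u x) *: u.
Proof.
rewrite /eichler !mulmxBl mulmxDl mul1mx -scalemxAl !outer_mulmx !gram11 !mul_mx_scalar.
by rewrite scalerA.
Qed.

Lemma eichler_perp n w (X : 'M[K]_(m, n)) : gram A u X = 0 ->
  eichler A u w *m X = X - u *m gram A w X.
Proof.
move=> uX; rewrite /eichler !mulmxBl mulmxDl mul1mx -scalemxAl !outer_mulmx uX.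
by rewrite !mulmx0 scaler0 addr0 subr0.
Qed.

Lemma eichler_isometry w : bform A u w = 0 ->
  gram A (eichler A u w) (eichler A u w) = A.
Proof.
move=> uw; apply: bform_ext => x y; rewrite -bform_mulmx !eichlerE.
have wu : bform A w u = 0 by rewrite bformC.
rewrite !bformE u_iso uw wu (bformC A_sym x u) (bformC A_sym x w).
by field.
Qed.

Lemma eichlerD w v : bform A u w = 0 -> bform A u v = 0 ->
  eichler A u w *m eichler A u v = eichler A u (w + v).
Proof.
move=> uw uv; apply: mulmx_ext => x; rewrite -mulmxA !eichlerE.
have wu : bform A w u = 0 by rewrite bformC.
rewrite !bformE u_iso uv wu (bformC A_sym v w).
apply/matrixP => i j; rewrite !mxE.
by field.
Qed.

Lemma eichler0 : eichler A u 0 = 1%:M.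
Proof.
apply: mulmx_ext => x; rewrite eichlerE !bform0l !(scaler0, mul0r, scale0r).
by rewrite addr0 !subr0 mul1mx.
Qed.

(** Halving [w] writes the transformation as a square, and the determinant of an isometry squares to
    1. *)
Lemma eichler_SO w : bform A u w = 0 -> SO A (eichler A u w).
Proof.
move=> uw; split; first exact: eichler_isometry.
have uw2 : bform A u (2^-1 *: w) = 0 by rewrite bformZr uw mulr0.
have -> : w = 2^-1 *: w + 2^-1 *: w.
  by rewrite -scalerDl (_ : _ + _ = 1) ?scale1r //; field.
rewrite -eichlerD // det_mulmx.
have /(congr1 determinant) := eichler_isometry uw2.
rewrite /gram !det_mulmx det_tr mulrAC -[RHS]mul1r => /mulIf; apply.
by move: A_unit; rewrite unitmxE unitfE.
Qed.

End Eichler.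

(** * Base change, signature and semi-definiteness on [u^perp] *)

Lemma map_gram (K K' : fieldType) (f : {rmorphism K -> K'}) m n k (A : 'M[K]_m)
  (X : 'M[K]_(m, n)) (Y : 'M[K]_(m, k)) :
  map_mx f (gram A X Y) = gram (map_mx f A) (map_mx f X) (map_mx f Y).
Proof. by rewrite /gram !map_mxM map_trmx. Qed.

Lemma map_bform (K K' : fieldType) (f : {rmorphism K -> K'}) m (A : 'M[K]_m) x y :
  bform (map_mx f A) (map_mx f x) (map_mx f y) = f (bform A x y).
Proof. by rewrite /bform -map_gram mxE. Qed.

Lemma map_eichler (K K' : fieldType) (f : {rmorphism K -> K'}) m (A : 'M[K]_m) u w :
  map_mx f (eichler A u w) = eichler (map_mx f A) (map_mx f u) (map_mx f w).
Proof.
rewrite /eichler !map_mxB map_mxD map_mx1 map_mxZ !map_mxM -!map_trmx.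
by rewrite map_bform fmorph_div rmorph_nat.
Qed.

Lemma bform_diag (K : fieldType) m (d : 'rV[K]_m) (z : 'cV[K]_m) :
  bform (diag_mx d) z z = \sum_i d 0 i * z i 0 ^+ 2.
Proof.
rewrite /bform /gram mul_mx_diag mxE; apply: eq_bigr => i _; rewrite !mxE.
by ring.
Qed.

Lemma signature_perp_ge0 (R : realType) p (A : 'M[R]_p.+1) (u x : 'cV[R]_p.+1) :
  has_signature_p1 A -> A^T = A -> u != 0 -> bform A u u = 0 ->
  bform A u x = 0 -> 0 <= bform A x x.
Proof.
move=> [P Pu PA] As u0 uu ux; have xu : bform A x u = 0 by rewrite bformC.
pose q (y : 'cV[R]_p.+1) := (invmx P *m y) ord_max 0.
have bq y : q y = 0 ->
    bform A y y = \sum_i (if i == ord_max then 0 else (invmx P *m y) i 0 ^+ 2).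
  move=> qy; rewrite -{1 2}(mulKVmx Pu y) bform_mulmx PA bform_diag.
  apply: eq_bigr => i _; rewrite mxE; case: eqVneq => [->|_]; last by rewrite mul1r.
  by rewrite -[_ ord_max 0]/(q y) qy expr0n mulr0.
(* On [q = 0] the form is a sum of squares, so a nonzero isotropic vector cannot lie there. *)
have q_ge0 y : q y = 0 -> 0 <= bform A y y.
  move=> /bq ->; apply: sumr_ge0 => i _; case: ifP => // _; exact: sqr_ge0.
have qu : q u != 0.
  apply: contra_neq u0 => qu; have /esym/eqP := bq _ qu; rewrite uu.
  rewrite psumr_eq0 => [/allP z|i _]; last by case: ifP => // _; exact: sqr_ge0.
  suff: invmx P *m u = 0 by move/(congr1 (mulmx P)); rewrite mulKVmx // mulmx0.
  apply/colP => i; rewrite [RHS]mxE; have /= := z i (mem_index_enum i).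
  by case: (eqVneq i ord_max) => [-> _|_]; [exact: qu | rewrite expf_eq0 /= => /eqP].
(* The combination [q u *: x - q x *: u] lies in the positive definite hyperplane [q = 0]. *)
have /q_ge0 : q (q u *: x - q x *: u) = 0.
  by rewrite /q mulmxBr -!scalemxAr !mxE mulrC subrr.
rewrite !bformE ux xu uu !(mulr0, oppr0, addr0) mulrA.
by rewrite pmulr_rge0 // -expr2 exprn_even_gt0.
Qed.

Lemma bform_CauchySchwarz (K : realFieldType) m (A : 'M[K]_m) u x y : A^T = A ->
  (forall z, bform A u z = 0 -> 0 <= bform A z z) ->
  bform A u x = 0 -> bform A u y = 0 ->
  bform A x y ^+ 2 <= bform A x x * bform A y y.
Proof.
move=> As psdA ux uy.
have q a b : 0 <= a ^+ 2 * bform A x x + 2 * a * b * bform A x y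
                  + b ^+ 2 * bform A y y.
  have := psdA (a *: x + b *: y); rewrite !bformE ux uy !mulr0 addr0.
  rewrite (bformC As y x) => /(_ erefl); congr (0 <= _).
  by ring.
move: (bform A x x) (bform A x y) (bform A y y) q (psdA _ ux) (psdA _ uy) => X Z Y q X0 Y0.
have [Y1|Y1|Y1] := ltgtP Y 0; first by move: Y1; rewrite ltNge Y0.
  (* The value at [Y x - Z y] is [Y (X Y - Z^2)]. *)
  rewrite -(ler_pM2l Y1); have := q Y (- Z); nra.
rewrite Y1 mulr0; have [->|Z0] := eqVneq Z 0; first by rewrite expr0n.
(* The form is only semi-definite, so [Y = 0] needs its own argument: for [Z != 0] this choice of
   coefficients gives the value [X - (X + 1) = -1]. *)
have := q 1 (- (X + 1) / (2 * Z)); rewrite Y1 mulr0 addr0.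
rewrite (_ : _ + _ = -1); first by lra.
by field.
Qed.

(** * Finiteness of bounded rational matrices with bounded denominators *)

Lemma int_mxP m n (M : 'M[rat]_(m, n)) :
  (forall i j, M i j \is a Num.int) <-> exists C, M = int_mx C.
Proof.
split=> [Mi|[C ->] i j]; last by rewrite mxE intr_int.
by exists (map_mx Num.floor M); apply/matrixP => i j; rewrite !mxE floorK.
Qed.

Lemma clear_denominators m n (M : 'M[rat]_(m, n)) :
  exists2 N : nat, (0 < N)%N & exists C, N%:R *: M = int_mx C.
Proof.
exists (\prod_i \prod_j `|denq (M i j)|)%N.
  by rewrite prodn_gt0 // => i; rewrite prodn_gt0 // => j; rewrite absz_gt0 denq_neq0.
apply/int_mxP => i j; rewrite mxE (bigD1 i) //= (bigD1 j) //= !natrM.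
have -> a b : `|denq (M i j)|%:R * a * b * M i j = (numq (M i j))%:~R * a * b.
  by rewrite natr_absz ger0_norm // numqE; ring.
by rewrite !rpredM ?natr_int ?intr_int.
Qed.

(** After scaling by [N] the entries are integers of absolute value at most [K], where [K] sums the
    entrywise bounds and so dominates each of them; shifted by [K] they are coded by ordinals up to
    [K + K]. *)
Lemma finite_bounded_mx m n (N : nat) (b : 'I_m -> 'I_n -> rat) : (0 < N)%N ->
  finite_set [set M : 'M[rat]_(m, n) |
    (exists C, N%:R *: M = int_mx C) /\ forall i j, M i j ^+ 2 <= b i j].
Proof.
move=> N0; pose K := (\sum_i \sum_j Num.bound (N%:R ^+ 2 * b i j))%N.
pose f (t : 'M['I_(K + K).+1]_(m, n)) : 'M[rat]_(m, n) :=
  N%:R^-1 *: map_mx (fun k : 'I_(K + K).+1 => (k : nat)%:R - K%:R) t.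
apply: (@sub_finite_set _ _ (range f)); last exact: finite_image.
move=> M [[C MC] Mb]; exists (map_mx (fun c : int => inord (absz (c + K%:Z))) C) => //.
have N0' : N%:R != 0 :> rat by rewrite pnatr_eq0 -lt0n.
apply: (scalerI N0'); rewrite MC /f scalerA mulfV // scale1r.
apply/matrixP => i j; rewrite !mxE.
have Cb : - K%:Z <= C i j <= K%:Z.
  rewrite -ler_norml.
  have /matrixP/(_ i j) := MC; rewrite !mxE => Cij.
  have C2 : (C i j)%:~R ^+ 2 <= (K%:Z)%:~R :> rat.
    rewrite -Cij exprMn; apply: (@le_trans _ _ (N%:R ^+ 2 * b i j)).
      by rewrite ler_wpM2l ?exprn_ge0.
    apply: (@le_trans _ _ (Num.bound (N%:R ^+ 2 * b i j))%:R).
      apply/ltW/archi_boundP; rewrite mulr_ge0 ?exprn_ge0 //.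
      exact: le_trans (sqr_ge0 _) (Mb i j).
    by rewrite -[leRHS]/(K%:R) ler_nat /K (bigD1 i) //= (bigD1 j) //= -addnA leq_addr.
  rewrite -rmorphXn ler_int in C2; apply: le_trans C2.
  move: (C i j) => c; case: (eqVneq c 0) => [->|c0]; first by rewrite normr0 sqr_ge0.
  by rewrite -(real_normK (num_real c)) expr2 ler_peMl // -gtz0_ge1 normr_gt0.
have CK0 : 0 <= C i j + K%:Z by rewrite -lerBlDr sub0r; case/andP: Cb.
rewrite inordK; last first.
  by rewrite ltnS -lez_nat gez0_abs // PoszD lerD2r; case/andP: Cb.
by rewrite natr_absz ger0_norm // rmorphD /= addrK.
Qed.

(* Projection along [u] onto the hyperplane orthogonal to [v], when [(u, v) = 1]. *)
Definition proj_along (K : fieldType) m (A : 'M[K]_m) (u v : 'cV[K]_m) : 'M[K]_m :=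
  1%:M - u *m v^T *m A.

Lemma proj_alongE (K : fieldType) m n (A : 'M[K]_m) u v (X : 'M[K]_(m, n)) :
  proj_along A u v *m X = X - u *m gram A v X.
Proof. by rewrite /proj_along mulmxBl mul1mx /gram !mulmxA. Qed.

(** The entries of a projected [X] are pairings of vectors of [u^perp], so Cauchy-Schwarz bounds
    them in terms of the fixed Gram matrix [S]; their denominators are bounded because [X] runs
    through a coset of a lattice. *)
Lemma finite_proj_along m n (A : 'M[rat]_m) u v (E : 'M[rat]_m)
  (h : 'M[rat]_(m, n)) (S : 'M[rat]_n) :
  A^T = A -> A \in unitmx ->
  (forall z, bform A u z = 0 -> 0 <= bform A z z) ->
  bform A u u = 0 -> bform A u v = 1 ->
  finite_set [set proj_along A u v *m X | X in
    [set X | [/\ gram A u X = 0, gram A X X = S & exists C, X = h + E *m int_mx C]]].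
Proof.
move=> As Au psdA uu uv; have vu : bform A v u = 1 by rewrite bformC.
have [N1 N1_gt0 [C1 C1E]] := clear_denominators (proj_along A u v *m h).
have [N2 N2_gt0 [C2 C2E]] := clear_denominators (proj_along A u v *m E).
(* [d i] reads off the [i]-th coordinate. Its correction [y i] lies in [u^perp] and has the same
   pairing with projected columns, which are orthogonal to [v]. *)
pose d i := invmx A *m (delta_mx i 0 : 'cV[rat]_m).
pose y i := d i - bform A (d i) u *: v.
pose b i j := bform A (y i) (y i) * S j j.
have N0 : (0 < N1 * N2)%N by rewrite muln_gt0 N1_gt0.
apply: sub_finite_set (finite_bounded_mx b N0) => _ [X [uX XS [C XE]] <-]; split.
  exists (N2%:R *: C1 + N1%:R *: C2 *m C).
  rewrite XE mulmxDr mulmxA scalerDr natrM mulrC -scalerA C1E mulrC -scalerA.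
  rewrite (scalemxAl N2%:R) C2E scalemxAl /int_mx map_mxD map_mxM !map_mxZ !rmorph_nat //.
move=> i j; pose x := col j X.
have ux : bform A u x = 0.
  by have /matrixP/(_ 0 j) := uX; rewrite gram_coef col_id mxE.
have -> : (proj_along A u v *m X) i j = bform A (y i) (x - bform A v x *: u).
  rewrite !bformE vu.
  transitivity (bform A (d i) (col j (proj_along A u v *m X))).
    by rewrite bform_delta // [RHS]mxE.
  rewrite colE -mulmxA -colE proj_alongE gram11 mul_mx_scalar !bformE; ring.
rewrite /b; have -> : S j j = bform A (x - bform A v x *: u) (x - bform A v x *: u).
  by rewrite -XS gram_coef -/x !bformE uu ux (bformC As x u) ux; ring.
apply: (bform_CauchySchwarz As psdA).
  by rewrite !bformE uv (bformC As _ u); ring.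
by rewrite !bformE ux uu; ring.
Qed.

(** * Connectedness: the hyperboloid and the identity component *)

Lemma mx_continuous (T : topologicalType) (K : numFieldType) m n
  (f : T -> 'M[K]_(m, n)) :
  (forall i j, continuous (fun x => f x i j)) -> continuous f.
Proof.
move=> fc x S [P xP PS].
have : nbhs x [set y | forall ij : 'I_m * 'I_n, P ij.1 ij.2 (f y ij.1 ij.2)].
  by apply: filter_forall => -[i j]; apply: (fc i j); exact: xP.
by apply: filterS => y Py; apply: PS => i j; exact: (Py (i, j)).
Qed.

Lemma mulmx_continuous_l (K : numFieldType) m n k (Z : 'M[K]_(n, k)) :
  continuous (fun g : 'M[K]_(m, n) => g *m Z).
Proof.
apply: mx_continuous => i j.
rewrite (_ : (fun _ => _) = fun g : 'M[K]_(m, n) => \sum_l g i l * Z l j); last first.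
  by apply/funext => g; rewrite mxE.
apply: continuous_big => [x|l _ g]; first exact: add_continuous.
exact: (cvgM (@coord_continuous K m n i l g) (cvg_cst (Z l j))).
Qed.

(** A connected subset of the group joining [1] to [g] sweeps [Z] along a connected subset of the
    hyperboloid that contains [Z] and [g Z]. *)
Lemma SO_id_hyperboloid (R : realType) m (A : 'M[rat]_m) (B : set 'cV[R]_m) g Z :
  hyperboloid_component A B -> SO_id (ext R A) g -> B Z -> B (g *m Z).
Proof.
move=> [Z0 _ ->] [D [D1 DSO Dc] Dg] BZ.
rewrite (same_connected_component BZ).
exists [set g *m Z | g in D]; last by exists g.
split.
- by exists 1%:M => //; rewrite mul1mx.
- move=> _ [f /DSO [fA _] <-]; rewrite /hyperboloid /= bform_isometry //.
  exact: connected_component_sub BZ.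
- apply: connected_continuous_connected => //.
  apply: continuous_subspaceT => x; exact: mulmx_continuous_l.
Qed.

(** The family [t |-> eichler A u (t *: w)] is polynomial in [t] and joins the identity, at [t = 0],
    to the given transformation, at [t = 1]. *)
Lemma eichler_SO_id (R : realType) m (A : 'M[R]_m) u w :
  A^T = A -> A \in unitmx -> bform A u u = 0 -> bform A u w = 0 ->
  SO_id A (eichler A u w).
Proof.
move=> As Au uu uw.
exists (range (fun t : R => eichler A u (t *: w))); last first.
  by exists 1 => //; rewrite scale1r.
split.
- by exists 0 => //; rewrite scale0r eichler0.
- by move=> _ [t _ <-]; apply: eichler_SO => //; rewrite bformZr uw mulr0.
- apply: connected_continuous_connected; first exact/connected_intervalP.
  apply: continuous_subspaceT.
  rewrite (_ : (fun t : R => _) = fun t : R =>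
    1%:M + t *: (w *m u^T *m A - u *m w^T *m A)
    - (t * t) *: ((bform A w w / 2) *: (u *m u^T *m A))); last first.
    apply/funext => t; rewrite /eichler linearZ !bformE /= -!scalemxAr -!scalemxAl.
    by rewrite scalerBr scalerA !addrA !mulrA.
  move=> t; apply: cvgB; first apply: cvgD; first exact: cvg_cst.
    by apply: cvgZ; [exact: cvg_id | exact: cvg_cst].
  by apply: cvgZ; [apply: cvgM; exact: cvg_id | exact: cvg_cst].
Qed.

(** The bound [K] depends on [S] only and not on the sequence [f], which later yields one exponent
    valid for all lattice vectors at once. *)
Lemma finite_pigeonhole (T : Type) (S : set T) : finite_set S ->
  exists2 K : nat, (0 < K)%N & forall f : nat -> T, (forall i, S (f i)) ->
    exists i k, (0 < k <= K)%N /\ f (i + k)%N = f i.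
Proof.
move=> /finite_set_leP[K /pcard_leP[g]]; exists K.+1 => // f fS.
have gK i : (g (f i) < K.+1)%N by apply: ltnW; exact: (@funS _ _ _ _ g _ (fS i)).
pose G (i : 'I_K.+2) := Ordinal (gK i).
have /injectivePn[i [j ij Gij]] : ~~ injectiveb G.
  apply/injectiveP => /leq_card; rewrite !card_ord ltnn //.
wlog ltij : i j ij Gij / (i < j)%N.
  move=> W; have [lt|gt|eq] := ltngtP i j; [exact: W lt | | ].
    by apply: W gt => //; rewrite eq_sym.
  by move: ij; rewrite (ord_inj eq) eqxx.
exists i, (j - i)%N; split.
  by rewrite subn_gt0 ltij leq_subLR (@leq_trans K.+1) ?leq_addl // -ltnS.
rewrite subnKC ?(ltnW ltij) //; apply: (inj (f := g)); rewrite ?inE //.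
by case: Gij.
Qed.

(** * Lattices and integral coordinates *)

Section Lattice.
Variables (m : nat) (L : set 'cV[rat]_m).
Hypothesis L_lat : full_lattice L.

Lemma latticeD x y : L x -> L y -> L (x + y).
Proof.
case: L_lat => E _ -> [a _ <-] [b _ <-]; exists (a + b) => //.
by rewrite /int_mx map_mxD mulmxDr.
Qed.

Lemma latticeN x : L x -> L (- x).
Proof.
case: L_lat => E _ -> [a _ <-]; exists (- a) => //.
by rewrite /int_mx map_mxN mulmxN.
Qed.

Lemma latticeB x y : L x -> L y -> L (x - y).
Proof. by move=> Lx Ly; apply: latticeD => //; exact: latticeN. Qed.

Lemma latticeZ c x : c \is a Num.int -> L x -> L (c *: x).
Proof.
case: L_lat => E _ -> /intrP[k ->] [a _ <-]; exists (k *: a) => //.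
by rewrite /int_mx map_mxZ -scalemxAr.
Qed.

Lemma lattice_multiple n (X : 'M[rat]_(m, n)) :
  exists2 N : nat, (0 < N)%N & forall c : 'cV[int]_n, L (N%:R *: X *m int_mx c).
Proof.
case: L_lat => E Eu ->.
have [N N0 [C NC]] := clear_denominators (invmx E *m X).
exists N => // c; exists (C *m c) => //.
by rewrite /int_mx map_mxM -/(int_mx C) -NC scalemxAr mulmxA mulKVmx.
Qed.

Lemma in_powerB n (X Y : 'M[rat]_(m, n)) :
  in_power L X -> in_power L Y -> in_power L (X - Y).
Proof. by move=> XL YL i; rewrite linearB; apply: latticeB; [exact: XL | exact: YL]. Qed.

End Lattice.

Lemma lattice_basis m (L : set 'cV[rat]_m) : full_lattice L ->
  exists2 E : 'M[rat]_m, E \in unitmx &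
    forall n (X : 'M[rat]_(m, n)), in_power L X <-> exists C, X = E *m int_mx C.
Proof.
case=> E Eu ->; exists E => // n X; split=> [XL|[C ->] i]; last first.
  exists (col i C) => //; rewrite !colE /int_mx map_mxM mulmxA; congr (_ *m _).
  by apply/matrixP => a b; rewrite !mxE; case: (_ && _).
exists (\matrix_(i, j) Num.floor ((invmx E *m X) i j)); apply/esym.
rewrite -[RHS](mulKVmx Eu); congr (_ *m _); apply/matrixP => i j.
rewrite 2!mxE floorK //; have [c _ cX] := XL j.
have -> : (invmx E *m X) i j = (invmx E *m col j X) i 0.
  by rewrite colE mulmxA -colE [RHS]mxE.
by rewrite -cX mulKmx // mxE intr_int.
Qed.

(** * Eichler transformations in the stabilizer of the lattice and in [Gamma] *)

Lemma ext_SO (R : realType) m (A g : 'M[rat]_m) : SO (ext R A) (ext R g) -> SO A g.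
Proof.
rewrite /SO /ext /= -map_gram det_map_mx => -[/map_mx_inj gA dg]; split=> //.
by apply: (fmorph_inj (@ratr R)); rewrite dg rmorph1.
Qed.

Lemma lattice_stab_SO (R : realType) m (A : 'M[rat]_m) L g :
  lattice_stab R A L g -> SO A g.
Proof. by case=> /connected_component_sub /ext_SO. Qed.

Section EichlerLattice.
Variables (R : realType) (m : nat) (A : 'M[rat]_m) (L : set 'cV[rat]_m).
Variable u : 'cV[rat]_m.
Hypotheses (A_sym : A^T = A) (A_unit : A \in unitmx).
Hypotheses (L_lat : full_lattice L) (L_dual : L `<=` dual_lattice A L).
Hypotheses (Lu : L u) (u_iso : bform A u u = 0).

(** Doubling [w] absorbs the denominator: the coefficient [(2w, 2w) / 2 = 2 (w, w)] is an
    integer. *)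
Lemma eichler_lattice w x : L w -> L x -> L (eichler A u (2 *: w) *m x).
Proof.
move=> Lw Lx; rewrite eichlerE !bformZl bformZr.
have -> : 2 * (2 * bform A w w) / 2 = 2 * bform A w w by field.
have int_L y z : L y -> L z -> bform A y z \is a Num.int by move=> /L_dual; apply.
rewrite scalerA.
by do ?[apply: latticeB => // | apply: latticeD => // | apply: latticeZ => // |
  apply: rpredM => // | exact: int_L].
Qed.

Lemma eichler_lattice_stab w : L w -> bform A u w = 0 ->
  lattice_stab R A L (eichler A u (2 *: w)).
Proof.
move=> Lw uw; have uw2 : bform A u (2 *: w) = 0 by rewrite bformZr uw mulr0.
split.
  rewrite /ext map_eichler; apply: eichler_SO_id.
  - by rewrite map_trmx A_sym.
  - by rewrite map_unitmx.
  - by rewrite map_bform u_iso rmorph0.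
  - by rewrite map_bform uw2 rmorph0.
apply/seteqP; split=> [_ [x Lx <-]|x Lx]; first exact: eichler_lattice.
(* The inverse transformation is the one attached to [-w]. *)
exists (eichler A u (2 *: - w) *m x).
  by apply: eichler_lattice => //; exact: latticeN.
rewrite mulmxA eichlerD ?bformZr ?bformNr ?uw ?oppr0 ?mulr0 //.
by rewrite -scalerDr subrr scaler0 eichler0 mul1mx.
Qed.

(** The powers [e i] of one transformation meet finitely many cosets of [Gamma], so [e k] lies in
    [Gamma] for some [0 < k <= K]. As [k] divides [K!], the constant [2 * K!] serves every [w]. *)
Lemma eichler_finite_index Gamma : subgroup Gamma ->
  finite_set (left_cosets (lattice_stab R A L) Gamma) ->
  exists2 M : nat, (0 < M)%N &
    forall w, L w -> bform A u w = 0 -> Gamma (eichler A u (M%:R *: w)).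
Proof.
move=> [Gu G1 GM GV] /finite_pigeonhole[K K0 pig].
exists (2 * K`!)%N; first by rewrite muln_gt0 fact_gt0.
move=> w Lw uw; have uZ c : bform A u (c *: w) = 0 by rewrite bformZr uw mulr0.
pose e (i : nat) := eichler A u (2 *: (i%:R *: w)).
have eD i j : e (i + j)%N = e i *m e j.
  rewrite /e eichlerD ?bformZr ?uw ?mulr0 //; congr (eichler _ _ _).
  by rewrite natrD (scalerDl w i%:R j%:R) scalerDr.
have [|i [k [/andP[k0 kK] ek]]] := pig (fun i => (fun h => e i *m h) @` Gamma).
  move=> i; exists (e i) => //; apply: eichler_lattice_stab => //.
  by apply: latticeZ => //; exact: natr_int.
have eu : e i \in unitmx.
  by apply: (isometry_unit A_unit); apply: eichler_isometry => //; rewrite scalerA uZ.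
have Gk : Gamma (e k).
  have : ((fun h => e (i + k)%N *m h) @` Gamma) (e (i + k)%N).
    by exists 1%:M => //; rewrite mulmx1.
  by rewrite ek eD => -[h Gh /(can_inj (mulKmx eu)) <-].
have Gkq q : Gamma (e (k * q)%N).
  elim: q => [|q IH]; last by rewrite mulnS eD; exact: GM.
  by rewrite muln0 /e scale0r scaler0 eichler0.
have /dvdnP[q Kq] : (k %| K`!)%N by apply: dvdn_fact; rewrite k0.
by rewrite natrM -scalerA Kq mulnC; exact: Gkq.
Qed.

End EichlerLattice.

(** * Dual vectors, neatness and geometric sums *)

Lemma exists_dual_vec (K : fieldType) m (A : 'M[K]_m) u :
  A^T = A -> A \in unitmx -> u != 0 -> exists v, bform A u v = 1.
Proof.
move=> As Au u0.
have /existsP[i ui] : [exists i, u i 0 != 0].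
  apply: contra_neqT u0 => /existsPn u0; apply/colP => i; rewrite mxE.
  exact/eqP/negPn.
exists ((u i 0)^-1 *: (invmx A *m delta_mx i 0)).
by rewrite bformZr bformC // bform_delta // mulVf.
Qed.

(** Over [algC] the polynomial [q = 1 + X + ... + X^(k-1)] splits, and the sum becomes a nonzero
    scalar times a product of factors [g - z] with [q(z) = 0]. A singular factor would make [z] an
    eigenvalue with [z^k = 1], hence [z = 1]; but [q(1) = k] is not zero. *)
Lemma geometric_sum_unit p (g : 'M[rat]_p.+1) k : (0 < k)%N ->
  (forall z : algC, eigenvalue (ext algC g) z -> z ^+ k = 1 -> z = 1) ->
  \sum_(i < k) g ^+ i \in unitmx.
Proof.
move=> k0 neat_g; pose q : {poly algC} := \sum_(i < k) 'X^i.
have qE z : q.[z] = \sum_(i < k) z ^+ i.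
  by rewrite /q horner_sum; apply: eq_bigr => i _; rewrite hornerXn.
have q1 : q.[1] != 0.
  rewrite qE (eq_bigr (fun=> 1)) => [|i _]; last by rewrite expr1n.
  by rewrite sumr_const card_ord pnatr_eq0 -lt0n.
have q0 : q != 0 by apply: contraNneq q1 => ->; rewrite horner0.
have hq : horner_mx (ext algC g) q = ext algC (\sum_(i < k) g ^+ i).
  rewrite /q /ext !rmorph_sum; apply: eq_bigr => i _.
  by rewrite !rmorphXn /= horner_mx_X.
rewrite -(map_unitmx (@ratr algC)) -[map_mx _ _]/(ext _ _) -hq.
have [rs qrs] := closed_field_poly_normal q.
have lq : lead_coef q != 0 by rewrite lead_coef_eq0.
rewrite qrs -mul_polyC rmorphM /= horner_mx_C unitmx_mul; apply/andP; split.
  by rewrite unitmxE det_scalar unitfE expf_neq0.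
rewrite rmorph_prod big_seq.
elim/big_ind: _ => [|x y xu yu|z zr]; first exact: unitmx1.
  by rewrite -[x * y]/(x *m y) unitmx_mul xu.
rewrite rmorphB /= horner_mx_X horner_mx_C.
have qz : q.[z] = 0.
  by apply/eqP; rewrite -[_ == 0]/(root q z) qrs rootZ // root_prod_XsubC.
have [//|nu] := boolP (_ \in unitmx).
have zk : z ^+ k = 1 by apply/eqP; rewrite -subr_eq0 subrX1 -qE qz mulr0.
have ez : eigenvalue (ext algC g) z.
  by rewrite /eigenvalue /eigenspace kermx_eq0 row_free_unit.
by move: q1; rewrite -(neat_g z ez zk) qz eqxx.
Qed.

(** * The stabilizer of an isotropic line and its unipotent elements *)

Section CuspStabilizer.
Variables (p : nat) (A : 'M[rat]_p.+1) (u : 'cV[rat]_p.+1).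
Hypotheses (A_sym : A^T = A) (A_unit : A \in unitmx).
Hypotheses (u0 : u != 0) (u_iso : bform A u u = 0).
Hypothesis psd_perp : forall z, bform A u z = 0 -> 0 <= bform A z z.

Lemma exp_isometry g i : gram A g g = A -> gram A (g ^+ i) (g ^+ i) = A.
Proof.
move=> gA; elim: i => [|i IH]; last by rewrite exprS; exact: isometry_mul.
by rewrite expr0 /gram trmx1 mul1mx mulmx1.
Qed.

Lemma exp_fix g i : g *m u = u -> g ^+ i *m u = u.
Proof.
move=> gu; elim: i => [|i IH]; first by rewrite expr0 mul1mx.
by rewrite exprS -[g * _]/(g *m _) -mulmxA IH.
Qed.

Lemma isometry_perp g x : gram A g g = A -> g *m u = u ->
  bform A u (g *m x) = bform A u x.
Proof. by move=> gA gu; rewrite -{1}gu bform_isometry. Qed.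

(* An isometry of [L] fixing [u] has finite order on [u^perp / u], which is
   positive definite. *)
Lemma power_trivial_perp (L : set 'cV[rat]_p.+1) g : full_lattice L ->
  (forall x, L x -> L (g *m x)) -> gram A g g = A -> g *m u = u ->
  exists2 k : nat, (0 < k)%N &
    forall x, bform A u x = 0 -> exists c, g ^+ k *m x - x = c *: u.
Proof.
move=> L_lat gL gA gu; have [v uv] := exists_dual_vec A_sym A_unit u0.
have [N N0 NL] := lattice_multiple L_lat (proj_along A v u).
(* An integral multiple of the projection along [v] onto [u^perp]: its columns lie in [L] and are
   orthogonal to [u], and it acts on [u^perp] as the scalar [N]. *)
pose Th := N%:R *: proj_along A v u.
have uTh : gram A u Th = 0.
  rewrite /Th /gram -scalemxAr -[X in _ *: X]/(gram A u (proj_along A v u)).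
  rewrite -[proj_along A v u]mulmx1 proj_alongE /gram mulmxBr !mulmxA.
  by rewrite -[u^T *m A *m v]/(gram A u v) gram11 uv mul1mx subrr scaler0.
have ThE x : bform A u x = 0 -> Th *m x = N%:R *: x.
  by move=> ux; rewrite /Th -scalemxAl proj_alongE gram11 ux mul_mx_scalar scale0r subr0.
have [E _ EL] := lattice_basis L_lat.
have ThL i : in_power L (g ^+ i *m Th).
  move=> j; rewrite colE -mulmxA; elim: i => [|i IH].
    rewrite expr0 mul1mx; have := NL (delta_mx j 0).
    rewrite (_ : int_mx _ = delta_mx j 0) //.
    by apply/matrixP => a b; rewrite !mxE; case: (_ && _).
  by rewrite exprS -[g * _]/(g *m _) -mulmxA; exact: gL.
(* All [g ^+ i *m Th] have the same Gram matrix, are orthogonal to [u] and are integral, so modulo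
   [u] two of them coincide. *)
have := finite_proj_along E 0 (gram A Th Th) A_sym A_unit psd_perp u_iso uv.
move=> /finite_pigeonhole[K _ pig].
have [|i [k [/andP[k0 _] /= ik]]] := pig (fun i => proj_along A u v *m (g ^+ i *m Th)).
  move=> i; exists (g ^+ i *m Th) => //; split.
  - by rewrite -[u in LHS](exp_fix i gu) gram_mulmx exp_isometry.
  - by rewrite gram_mulmx exp_isometry.
  - by have /EL[C ->] := ThL i; exists C; rewrite add0r.
exists k => // x ux; have N0' : N%:R != 0 :> rat by rewrite pnatr_eq0 -lt0n.
have giu : g ^+ i \in unitmx by exact: (isometry_unit A_unit (exp_isometry i gA)).
have /(congr1 (fun M => N%:R^-1 *: (M *m x))) := ik.
rewrite /= -!mulmxA !ThE // -!scalemxAr !scalerA mulVf // !scale1r !proj_alongE.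
rewrite exprD -[g ^+ i * _]/(g ^+ i *m _) -mulmxA !gram11 !mul_mx_scalar.
set a := bform _ _ _; set b := bform _ _ _ => E1.
(* The coincidence says [g^i (g^k x - x) = (a - b) u]; as [g^i] fixes [u], it can be cancelled. *)
exists (a - b); apply: (can_inj (mulKmx giu)).
rewrite mulmxBr -scalemxAr exp_fix // scalerBl; apply/eqP.
by rewrite subr_eq addrAC -addrA -E1 subrKC.
Qed.

(** With [Q = 1 + g + ... + g^(k-1)] one has [g^k - 1 = (g - 1) Q]. Neatness makes [Q] invertible,
    so [x = Q y] and [(g - 1) x = (g^k - 1) y] is a multiple of [u] as soon as [y] lies in
    [u^perp]. *)
Lemma neat_trivial_perp (L : set 'cV[rat]_p.+1) (Gamma : set 'M[rat]_p.+1) g :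
  full_lattice L -> (forall x, L x -> L (g *m x)) -> gram A g g = A ->
  neat Gamma -> Gamma g -> g *m u = u ->
  forall x, bform A u x = 0 -> exists c, g *m x - x = c *: u.
Proof.
move=> L_lat gL gA neatG Gg gu.
have [k k0 gk] := power_trivial_perp L_lat gL gA gu.
have Qu : \sum_(i < k) g ^+ i \in unitmx.
  by apply: geometric_sum_unit => // z ez; exact: neatG Gg _ (EigGen ez) _ k0.
set Q := \sum_(i < k) g ^+ i in Qu => x ux.
pose y := invmx Q *m x.
have xQ : x = Q *m y by rewrite /y mulKVmx.
(* Each power of [g] preserves the pairing with [u], so [(u, Q y) = k (u, y)]. *)
have uy : bform A u y = 0.
  have : bform A u (Q *m y) = k%:R * bform A u y.
    rewrite /Q mulmx_suml /bform /gram mulmx_sumr summxE.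
    rewrite (eq_bigr (fun=> bform A u y)) => [|i _].
      by rewrite sumr_const card_ord mulr_natl.
    by rewrite -(@isometry_perp (g ^+ i)) ?exp_isometry ?exp_fix.
  rewrite -xQ ux => /esym/eqP; rewrite mulf_eq0 pnatr_eq0.
  by case/orP => [/eqP k00|/eqP //]; rewrite k00 in k0.
have [c cE] := gk y uy; exists c; rewrite -cE xQ.
rewrite -[X in _ - X]mul1mx -[y in RHS]mul1mx !mulmxA -!mulmxBl; congr (_ *m _).
rewrite mulmx1; congr (_ *m _); exact: esym (subrX1 g k).
Qed.

(** An explicit model inside the unipotent radical: trivial on [u] and on [u^perp / u]. Being a
    normal unipotent subgroup suffices, since [unipotent_radical] is the union of all of these. *)
Definition line_unipotent : set 'M[rat]_p.+1 :=
  [set g | [/\ SO A g, g *m u = u &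
     forall x, bform A u x = 0 -> exists c, g *m x - x = c *: u]].

Lemma line_unipotent_normal :
  normal_unipotent (line_stab A (range (fun c : rat => c *: u))) line_unipotent.
Proof.
have Nu g : line_unipotent g -> g \in unitmx.
  by move=> [[gA _] _ _]; exact: isometry_unit gA.
have NV g : line_unipotent g -> line_unipotent (invmx g).
  move=> Ng; have [gSO gu gp] := Ng; have gU := Nu g Ng; split; first exact: SO_inv.
    by rewrite -{1}gu mulKmx.
  move=> x ux; have [c cE] := gp x ux; exists (- c).
  apply: (can_inj (mulKmx gU)); rewrite mulmxBr mulKVmx // -scalemxAr gu.
  by rewrite scaleNr -cE opprB.
split; first split.
- exact: Nu.
- split; rewrite ?mul1mx //; first by split; rewrite ?det1 // /gram trmx1 mul1mx mulmx1.
  by move=> x _; exists 0; rewrite mul1mx subrr scale0r.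
- move=> g f [gSO gu gp] [fSO fu fp]; split; first exact: SO_mul.
    by rewrite -mulmxA fu.
  move=> x ux; have [c cE] := fp x ux; have [d dE] := gp x ux; exists (c + d).
  rewrite -mulmxA -[f *m x](subrK x) cE mulmxDr -scalemxAr gu.
  by rewrite -addrA dE scalerDl.
- exact: NV.
- move=> g [gSO gu _]; split=> //; apply/seteqP; split=> [_ [_ [c _ <-] <-]|_ [c _ <-]].
    by exists c => //; rewrite -scalemxAr gu.
  by exists (c *: u); [exists c | rewrite -scalemxAr gu].
- move=> g x [gSO gl] [xSO xu xp].
  have gU : g \in unitmx by case: gSO => gA _; exact: isometry_unit gA.
  (* An element of the line stabilizer may scale [u]; the factor cancels under conjugation. *)
  have [a aE] : exists a, g *m u = a *: u.
    have : (mulmx g @` range (fun c : rat => c *: u)) (g *m u).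
      by exists u => //; exists 1; rewrite ?scale1r.
    by rewrite gl => -[a _ <-]; exists a.
  have a0 : a != 0.
    apply: contra_neq u0 => a0; apply: (can_inj (mulKmx gU)).
    by rewrite aE a0 scale0r mulmx0.
  have gVu : invmx g *m u = a^-1 *: u.
    apply: (can_inj (mulKmx gU)); rewrite mulKVmx // -scalemxAr aE scalerA.
    by rewrite mulVf // scale1r.
  split.
  + by apply: SO_mul; [exact: SO_mul | exact: SO_inv].
  + by rewrite -!mulmxA gVu -!scalemxAr xu aE scalerA mulVf // scale1r.
  + move=> y uy; have [|c cE] := xp (invmx g *m y).
      have -> : u = a *: (invmx g *m u) by rewrite gVu scalerA mulfV // scale1r.
      by rewrite bformZl bform_isometry ?uy ?mulr0 //; case: gSO => gA _; exact: isometry_inv.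
    exists (c * a); rewrite -scalerA -aE scalemxAr -cE mulmxBr mulKVmx //.
    by rewrite !mulmxA.
(* [g - 1] maps the whole space into [u^perp], then [u^perp] into the line of [u], and kills [u], so
   its cube vanishes. *)
- move=> g [[gA _] gu gp]; exists 3%N; apply: mulmx_ext => x; rewrite mul0mx /= mulmx1.
  have [|c cE] := gp ((g - 1%:M) *m x).
    by rewrite mulmxBl mul1mx bformDr bformNr isometry_perp // subrr.
  rewrite -!mulmxA (mulmxBl g 1%:M ((g - 1%:M) *m x)) mul1mx cE.
  by rewrite -scalemxAr mulmxBl gu mul1mx subrr scaler0.
Qed.

End CuspStabilizer.

(** * Finiteness of orbits over one cusp *)

(** Applied twice below: first to fix a tuple modulo [u], then to fix residues of its integral
    coordinates along [u]. *)
Lemma finite_image_fibers (T U V : Type) (f : T -> U) (o : T -> V) (S : set T) :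
  finite_set (f @` S) ->
  (forall x0, S x0 -> finite_set (o @` [set x | S x /\ f x = f x0])) ->
  finite_set (o @` S).
Proof.
move=> fS oS; pose F y := o @` [set x | S x /\ f x = y].
apply: (@sub_finite_set _ _ (\bigcup_(y in f @` S) F y)).
  by move=> _ [x Sx <-]; exists (f x); [exists x | exists x].
by apply: bigcup_finite => // _ [x Sx <-]; exact: oS.
Qed.

Lemma orbit_of_mul m n (G : set 'M[rat]_m) (X : 'M[rat]_(m, n)) g : subgroup G ->
  G g -> orbit_of G (g *m X) = orbit_of G X.
Proof.
move=> [Gu _ GM GV] Gg; apply/seteqP; split=> _ [f Gf ->].
  by exists (f *m g); [exact: GM | rewrite mulmxA].
exists (f *m invmx g); first by apply: GM => //; exact: GV.
by rewrite mulmxA mulmxKV //; exact: Gu.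
Qed.

Lemma coset_powerB m n (L : set 'cV[rat]_m) (h X Y : 'M[rat]_(m, n)) :
  full_lattice L -> coset_power L h X -> coset_power L h Y -> in_power L (X - Y).
Proof.
move=> L_lat XL YL; rewrite (_ : X - Y = (X - h) - (Y - h)); last by rewrite opprB addrA subrK.
exact: in_powerB.
Qed.

Lemma mulmx_rank_inj (K : fieldType) m n (X : 'M[K]_(m, n)) (c : 'cV[K]_n) :
  \rank X = n -> X *m c = 0 -> c = 0.
Proof.
move=> Xn /(congr1 trmx); rewrite trmx_mul trmx0 => /eqP.
rewrite mulmx_free_eq0; last by rewrite /row_free mxrank_tr Xn.
by move/eqP/(congr1 trmx); rewrite trmxK trmx0.
Qed.

(* Over a cusp, [u^perp / u] leaves finitely many possibilities for [X] modulo
   [u]; the remaining freedom is a row [d] of integers, and those with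
   [d . a = 0] are realized by Eichler transformations up to finite index. *)
Lemma finite_cusp_orbits m n (A : 'M[rat]_m) (u : 'cV[rat]_m) (L : set 'cV[rat]_m)
  (Gamma : set 'M[rat]_m) (h : 'M[rat]_(m, n)) (G : 'M[rat]_n) (a : 'cV[int]_n) M
  (S : set 'M[rat]_(m, n)) :
  A^T = A -> A \in unitmx -> u != 0 -> bform A u u = 0 ->
  (forall z, bform A u z = 0 -> 0 <= bform A z z) ->
  full_lattice L -> (forall c, L (c *: u) -> c \is a Num.int) ->
  subgroup Gamma -> (0 < M)%N ->
  (forall w, L w -> bform A u w = 0 -> Gamma (eichler A u (M%:R *: w))) ->
  int_mx a != 0 ->
  (forall X, S X -> [/\ gram A u X = 0, gram A X X = G, coset_power L h X,
      \rank X = n & exists2 nu, X *m int_mx a = nu *: u & `|nu| < 1]) ->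
  finite_set (orbit_of Gamma @` S).
Proof.
move=> As Au u0 uu psdA L_lat uL Ggp M0 eG a0 SP.
have [v uv] := exists_dual_vec As Au u0.
have [E _ EL] := lattice_basis L_lat.
apply: (@finite_image_fibers _ _ _ (mulmx (proj_along A u v))).
  apply: sub_finite_set (finite_proj_along E h G As Au psdA uu uv).
  move=> _ [X /SP[uX XG /EL[C XC] _ _] <-]; exists X => //; split=> //.
  by exists C; rewrite -XC addrC subrK.
move=> X0 SX0; have [uX0 X0G X0L X0n [nu0 X0a _]] := SP _ SX0.
(* Since [X0] has rank [n] and [A] is invertible, a vector with prescribed pairings against the
   columns of [X0] exists. *)
have [Y Y1] : exists Y, X0^T *m A *m Y = 1%:M.
  apply/row_freeP; rewrite /row_free mxrankMfree ?row_free_unit //.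
  by rewrite mxrank_tr X0n.
have [N N0 NY] := lattice_multiple L_lat Y.
(* [N] brings the solution vector into [L], [M] brings its Eichler transformation into [Gamma], and
   the factor 2 ensures [T >= 2], to be played against [|nu2 - nu1| < 2]. *)
have [T TE T2] : exists2 T, T = (2 * M * N)%N & (2 <= T)%N.
  by exists (2 * M * N)%N => //; rewrite -mulnA leq_pmulr // muln_gt0 M0.
pose d X := gram A v (X - X0).
pose F := [set X | S X /\ proj_along A u v *m X = proj_along A u v *m X0].
have dE X : F X -> X = X0 + u *m d X.
  move=> [_ /eqP]; rewrite -subr_eq0 -mulmxBr proj_alongE subr_eq0 => /eqP /= <-.
  by rewrite addrC subrK.
(* Column [j] of [X - X0] lies in [L] and equals [(d X)_j u], and [u] is primitive in [L]. *)
have d_int X j : F X -> d X 0 j \is a Num.int.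
  move=> FX; have [/SP[_ _ XL _ _] _] := FX; apply: uL.
  have := coset_powerB L_lat XL X0L j; rewrite {1}(dE X FX) addrC addKr colE -mulmxA -colE.
  by rewrite [col _ _]mx11_scalar mul_mx_scalar mxE.
pose fl X j := Num.floor (d X 0 j).
(* Residues modulo [T] are stored in ['I_T.+1] because [inord] asks for a successor bound. *)
pose red (q : rat) : 'I_T.+1 := inord (absz (Num.floor q %% T)%Z).
apply: (@finite_image_fibers _ _ _ (fun X => map_mx red (d X))).
  exact: finite_finset.
move=> X1 FX1; apply: sub_finite_set (finite_set1 (orbit_of Gamma X1)).
move=> _ [X2 [FX2 red12] <-] /=.
have [[SX1 _] [SX2 _]] := (FX1, FX2).
have [uX1 _ _ _ [nu1 X1a nu1_lt]] := SP _ SX1.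
have [_ _ _ _ [nu2 X2a nu2_lt]] := SP _ SX2.
have [e eE] : exists e : 'cV[int]_n, d X2 - d X1 = T%:R *: (int_mx e)^T.
  exists (\col_j ((fl X2 j - fl X1 j) %/ T)%Z).
  apply/rowP => j.
  have dfl X : F X -> d X 0 j = (fl X j)%:~R by move=> FX; rewrite floorK ?d_int.
  have -> : (d X2 - d X1) 0 j = (fl X2 j - fl X1 j)%:~R.
    by rewrite rmorphB /= -!dfl // [LHS]mxE [X in _ + X]mxE.
  rewrite 3!mxE mxE mulrC.
  rewrite -[T%:R]/(T%:Z%:~R) -rmorphM /= divzK // -eqz_mod_dvd; apply/eqP.
  have T0 : T%:Z != 0 by rewrite eqz_nat -lt0n; exact: leq_trans T2.
  have /rowP/(_ j) := red12; rewrite [LHS]mxE [RHS]mxE /red => /(congr1 val) /=.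
  have red_lt q : (absz (Num.floor q %% T)%Z < T.+1)%N.
    rewrite ltnS -lez_nat gez0_abs ?modz_ge0 //; apply: ltW.
    by have := ltz_mod (Num.floor q) T0.
  rewrite !inordK // => /(congr1 Posz); rewrite !gez0_abs ?modz_ge0 //.
(* Applying both tuples to [a] gives [nu2 - nu1 = T (e . a)]. The left side is smaller than 2 in
   absolute value and [T >= 2], so the integer [e . a] is zero. *)
have ea : (int_mx e)^T *m int_mx a = 0.
  have eaE : (int_mx e)^T *m int_mx a = int_mx (e^T *m a).
    by rewrite /int_mx map_mxM map_trmx.
  have : (X2 - X1) *m int_mx a = (T%:R * ((e^T *m a) 0 0)%:~R) *: u.
    rewrite {1}(dE _ FX2) {1}(dE _ FX1) opprD addrACA subrr add0r -mulmxBr eE.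
    rewrite -mulmxA -scalemxAl eaE [int_mx _]mx11_scalar -scalemxAr mul_mx_scalar.
    by rewrite scalerA mxE.
  rewrite mulmxBl X1a X2a -scalerBl => /(congr1 (bform A ^~ v)).
  rewrite !bformZl uv !mulr1 => nuE; rewrite eaE [e^T *m a]mx11_scalar.
  case: (eqVneq ((e^T *m a) 0 0) 0) => [->|k0].
    by apply/matrixP => i j; rewrite !mxE mul0rn.
  have : `|nu2 - nu1| < 2.
    by apply: le_lt_trans (ler_normB _ _) _; rewrite -[2]/(1 + 1) ltrD.
  rewrite nuE normrM normr_nat ltNge => /negP[].
  have k1 : 1 <= `|((e^T *m a) 0 0)%:~R| :> rat.
    by rewrite -intr_norm -[1]/(1%:~R) ler_int -gtz0_ge1 normr_gt0.
  by rewrite -[2]mulr1 ler_pM ?ler0n // ler_nat.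
(* Chosen so that [(x_j, w) = -2 N e_j] for the columns of [X0]; the Eichler transformation of [M w]
   then adds [T u e^T], which is [X2 - X1]. *)
pose w := N%:R *: Y *m int_mx ((-2) *: e).
have intE : int_mx ((-2) *: e) = (- 2) *: int_mx e.
  by rewrite /int_mx map_mxZ rmorphN rmorph_nat.
have Lw : L w by exact: NY.
have X0w : gram A X0 w = (- (N%:R * 2)) *: int_mx e.
  by rewrite /gram /w intE -!scalemxAl -!scalemxAr mulmxA Y1 mul1mx scalerA mulrN.
have nu00 : nu0 != 0.
  apply: contra_neq a0 => nu00; apply: (mulmx_rank_inj X0n).
  by rewrite X0a nu00 scale0r.
(* As [u] is a multiple of [X0 . a], this orthogonality is the relation [e . a = 0]. *)
have uw : bform A u w = 0.
  have -> : u = nu0^-1 *: (X0 *m int_mx a) by rewrite X0a scalerA mulVf // scale1r.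
  rewrite bformZl /bform /gram trmx_mul -!mulmxA (mulmxA _ A) -[X in _ *m X]/(gram A X0 w).
  rewrite X0w -scalemxAr -[_ *m _]trmxK trmx_mul trmxK ea trmx0 scaler0 mxE.
  by rewrite mulr0.
have wX1 : gram A w X1 = (- (N%:R * 2)) *: (int_mx e)^T.
  rewrite {1}(dE _ FX1) /gram mulmxDr mulmxA -!/(gram _ _ _) gram11.
  rewrite (bformC As) uw -(tr_gram As) X0w linearZ /= mul_scalar_mx scale0r addr0.
  by [].
rewrite -(orbit_of_mul X1 Ggp (eG w Lw uw)) eichler_perp //; congr orbit_of.
have -> : gram A (M%:R *: w) X1 = (- T%:R) *: (int_mx e)^T.
  rewrite /gram linearZ -!scalemxAl /= -/(gram A w X1) wX1 scalerA; congr (_ *: _).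
  by rewrite TE !natrM; ring.
rewrite scaleNr mulmxN opprK -eE mulmxBr {1}(dE _ FX1) {1}(dE _ FX2).
by rewrite addrACA subrr addr0 ?addrA addrC.
Qed.

(** * Primitive vectors and the kernel of [beta] *)

(** By Bezout, the naturals [x] with [c x] integral are closed under gcd, and the gcd of the entries
    is 1. *)
Lemma primitive_int n (a : 'cV[int]_n) (c : rat) : primitive_vec a ->
  (forall i, c * (a i 0)%:~R \is a Num.int) -> c \is a Num.int.
Proof.
move=> a1 ca; have -> : c = c * (\big[gcdn/0%N]_(i < n) absz (a i 0%R))%:R by rewrite a1 mulr1.
elim/big_ind: _ => [|x y cx cy|i _]; first by rewrite mulr0.
  have [->|x0] := posnP x; first by rewrite gcd0n.
  case: (egcdnP y x0) => s t st _.
  have -> : (gcdn x y)%:R = s%:R * x%:R - t%:R * y%:R :> rat.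
    by rewrite -!natrM st natrD addrC addKr.
  by rewrite mulrBr !(mulrCA c) rpredB // rpredM ?natr_int.
rewrite natr_absz intr_norm; case: (ger0P (_ : rat)) => _ //.
by rewrite mulrN rpredN.
Qed.

Lemma primitive_neq0 n (a : 'cV[int]_n) : primitive_vec a -> int_mx a != 0.
Proof.
move=> a1; apply/eqP => a0.
(* If [a] were zero, every rational multiple of it would be integral, forcing [1/2] to be an
   integer. *)
have : (2^-1 : rat) \is a Num.int.
  apply: (primitive_int a1) => i; have /colP/(_ i) := a0.
  by rewrite !mxE => ->; rewrite mulr0.
by [].
Qed.

Lemma kernel_line (K : fieldType) n (beta : 'M[K]_n) (a c : 'cV[K]_n) :
  (0 < n)%N -> \rank beta = n.-1 -> a != 0 -> beta *m a = 0 -> beta *m c = 0 ->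
  exists k, c = k *: a.
Proof.
move=> n0 rb a0 ba bc.
have ker (x : 'cV_n) : beta *m x = 0 -> (x^T <= kermx beta^T)%MS.
  by move=> bx; apply/sub_kermxP; rewrite -trmx_mul bx trmx0.
have ra : \rank a^T = 1%N by rewrite rank_rV trmx_eq0 a0.
have : (kermx beta^T <= a^T)%MS.
  rewrite -(geq_leqif (mxrank_leqif_sup (ker _ ba))) ra mxrank_ker mxrank_tr rb.
  by rewrite -subn1 subKn.
move=> /(submx_trans (ker _ bc)) /sub_rVP[k kE]; exists k.
by apply: trmx_inj; rewrite kE linearZ.
Qed.

(** The kernel is a line, and primitivity of [a] and of [b] makes both [s] and its inverse
    integral. *)
Lemma primitive_kernel_sign n (beta : 'M[rat]_n) (a b : 'cV[int]_n) :
  (0 < n)%N -> \rank beta = n.-1 -> primitive_vec a -> primitive_vec b ->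
  beta *m int_mx a = 0 -> beta *m int_mx b = 0 ->
  exists2 s : rat, int_mx b = s *: int_mx a & `|s| = 1.
Proof.
move=> n0 rb pa pb ba bb.
have [s sE] := kernel_line n0 rb (primitive_neq0 pa) ba bb.
have s0 : s != 0.
  by apply: contra_neq (primitive_neq0 pb) => s0; rewrite sE s0 scale0r.
have sI : s \is a Num.int.
  apply: (primitive_int pa) => i; have /colP/(_ i) := sE; rewrite !mxE => <-.
  exact: intr_int.
have sVI : s^-1 \is a Num.int.
  apply: (primitive_int pb) => i; have /colP/(_ i) := sE; rewrite !mxE => ->.
  by rewrite mulKf // intr_int.
exists s => //; apply/eqP; rewrite eq_le norm_intr_ge1 // andbT.
by rewrite -invf_ge1 ?normr_gt0 // -normfV norm_intr_ge1 // invr_eq0.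
Qed.

(** * The radical of the span and its distinguished generator *)

Section Radical.
Variables (m n : nat) (A : 'M[rat]_m) (beta : 'M[rat]_n).
Hypotheses (A_sym : A^T = A) (A_unit : A \in unitmx).

Lemma Omega_s_gram X : Omega_s A beta X -> gram A X X = 2 *: beta.
Proof. by move=> [<- _]; rewrite scalerA mulfV // scale1r. Qed.

(** The Gram matrix of [X] is [2 beta], so being orthogonal to all columns is a kernel condition on
    the coefficients. *)
Lemma radicalP X : Omega_s A beta X -> forall x,
  radical A (span_of X) x <-> exists2 c, x = X *m c & beta *m c = 0.
Proof.
move=> OX x; have XG := Omega_s_gram OX; split=> [[[c _ <-] cX]|[c -> bc]].
  exists c => //.
  suff : gram A X (X *m c) = 0.
    rewrite gram_mulr XG -scalemxAl => /eqP; rewrite scaler_eq0 pnatr_eq0 /=.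
    by move/eqP.
  apply/colP => i; rewrite gram_coef col_id mxE (bformC A_sym); apply: cX.
  by exists (delta_mx i 0) => //; rewrite colE.
split=> [|_ [d _ <-]]; first by exists c.
by rewrite (bformC A_sym) /bform gram_mull gram_mulr XG -scalemxAl bc scaler0 mulmx0 mxE.
Qed.

Lemma span_of_mul (g : 'M[rat]_m) (X : 'M[rat]_(m, n)) :
  span_of (g *m X) = mulmx g @` span_of X.
Proof.
apply/seteqP; split=> [_ [c _ <-]|_ [_ [c _ <-] <-]].
  by exists (X *m c); [exists c | rewrite mulmxA].
by exists c => //; rewrite mulmxA.
Qed.

Lemma radical_mul g U : gram A g g = A ->
  radical A (mulmx g @` U) = mulmx g @` radical A U.
Proof.
move=> gA; apply/seteqP; split=> [_ [[x Ux <-] xU]|_ [x [Ux xU] <-]].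
  exists x => //; split=> // y Uy; rewrite -(bform_isometry x y gA).
  by apply: xU; exists y.
split; first by exists x.
by move=> _ [y Uy <-]; rewrite bform_isometry //; exact: xU.
Qed.

Lemma Omega_s_mul g X : gram A g g = A -> Omega_s A beta X -> Omega_s A beta (g *m X).
Proof.
move=> gA [XG Xn]; split.
  by rewrite gram_mulmx gA.
have gu := isometry_unit A_unit gA.
by rewrite -mxrank_tr trmx_mul mxrankMfree ?mxrank_tr // row_free_unit unitmx_tr.
Qed.

End Radical.

(** Two generators of the same infinite cyclic group differ by a sign, and negativity at a point of
    [B] decides the sign. *)
Lemma is_u_unique (R : realType) m n (A : 'M[rat]_m) L (B : set 'cV[R]_m)
  (X X' : 'M[rat]_(m, n)) u u' : B !=set0 -> u != 0 ->
  is_u A L B X u -> is_u A L B X' u' ->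
  radical A (span_of X) = radical A (span_of X') -> u = u'.
Proof.
move=> [Z BZ] u0 [uE uB] [u'E u'B] rad.
have [k _ kE] : range (fun k : int => u' *~ k) u.
  by rewrite -u'E -rad uE; exists 1.
have [l _ lE] : range (fun k : int => u *~ k) u'.
  by rewrite -uE rad u'E; exists 1.
have kl : l * k = 1.
  have : ((l * k)%:~R - 1) *: u = 0.
    by rewrite scalerBl scale1r scaler_int mulrzA lE kE subrr.
  move/eqP; rewrite scaler_eq0 (negPf u0) orbF subr_eq0 => /eqP lk1.
  by apply: (@intr_inj rat); rewrite lk1.
have k0 : 0 < k.
  have := uB Z BZ; rewrite -kE -scaler_int /ext map_mxZ bformZl rmorph_int.
  by rewrite nmulr_llt0 ?ltr0z //; exact: u'B.
have l0 : 0 < l by rewrite -(pmulr_lgt0 _ k0) kl.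
have l1 : 1 <= l by rewrite -gtz0_ge1.
have k1 : k = 1.
  apply/eqP; rewrite eq_le -gtz0_ge1 k0 andbT -[X in _ <= X]kl.
  by rewrite -[X in X <= _]mul1r ler_pM2r.
by rewrite -kE k1.
Qed.

Section ReducedLine.
Variables (R : realType) (m n : nat) (A : 'M[rat]_m) (beta : 'M[rat]_n).
Variables (L : set 'cV[rat]_m) (B : set 'cV[R]_m) (X : 'M[rat]_(m, n)).
Variables (u : 'cV[rat]_m) (a : 'cV[int]_n).
Hypotheses (A_sym : A^T = A) (n0 : (0 < n)%N) (beta_rank : \rank beta = n.-1).
Hypotheses (L_lat : full_lattice L) (OX : Omega_s A beta X) (uX : is_u A L B X u).
Hypotheses (a_prim : primitive_vec a) (ba : beta *m int_mx a = 0).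

Lemma is_u_mem : radical A (span_of X) u /\ L u.
Proof.
case: uX => rE _; have : range (fun k : int => u *~ k) u by exists 1.
by rewrite -rE.
Qed.

(** If [u] were zero, the radical would contain no nonzero lattice vector; but a multiple of [X . a]
    is one, as [X] has full column rank. *)
Lemma is_u_neq0 : u != 0.
Proof.
have a0 := primitive_neq0 a_prim; have [N N0 NL] := lattice_multiple L_lat X.
apply: contra_neq a0 => u0; case: OX => _ Xn; apply: (mulmx_rank_inj Xn).
have : (radical A (span_of X) `&` L) (N%:R *: (X *m int_mx a)).
  split; last by rewrite scalemxAl; exact: NL.
  apply/(radicalP A_sym OX); exists (N%:R *: int_mx a).
    by rewrite -scalemxAr.
  by rewrite -scalemxAr ba scaler0.
case: uX => -> _ [k _ /esym/eqP]; rewrite u0 mul0rz scaler_eq0 pnatr_eq0.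
by rewrite eqn0Ngt N0 => /eqP.
Qed.

Lemma is_u_radical : radical A (span_of X) = range (fun c : rat => c *: u).
Proof.
have [/(radicalP A_sym OX)[b uE bb] _] := is_u_mem.
have b0 : b != 0 by apply: contra_neq is_u_neq0 => b0; rewrite uE b0 mulmx0.
apply/seteqP; split=> [_ /(radicalP A_sym OX)[c -> bc]|_ [c _ <-]].
  have [k ->] := kernel_line n0 beta_rank b0 bb bc.
  by exists k => //; rewrite uE -scalemxAr.
apply/(radicalP A_sym OX); exists (c *: b); first by rewrite uE -scalemxAr.
by rewrite -scalemxAr bb scaler0.
Qed.

Lemma is_u_gram : gram A u X = 0.
Proof.
have [[_ uS] _] := is_u_mem; apply/rowP => j; rewrite gram_coef col_id mxE.
by apply: uS; exists (delta_mx j 0) => //; rewrite colE.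
Qed.

Lemma is_u_isotropic : bform A u u = 0.
Proof. by have [[uS u_perp] _] := is_u_mem; exact: u_perp. Qed.

Lemma is_u_primitive c : L (c *: u) -> c \is a Num.int.
Proof.
move=> Lcu; have : (radical A (span_of X) `&` L) (c *: u).
  by split => //; rewrite is_u_radical; exists c.
case: uX => -> _ [k _]; rewrite -scaler_int => /eqP.
rewrite -subr_eq0 -scalerBl scaler_eq0 (negPf is_u_neq0) orbF subr_eq0 => /eqP <-.
exact: intr_int.
Qed.

End ReducedLine.

(** Negativity is transported by [(g u, Z) = (u, g^-1 Z)], where [g^-1 Z] stays in [B]. *)
Lemma is_u_mul (R : realType) m n (A : 'M[rat]_m) L (B : set 'cV[R]_m)
  (X : 'M[rat]_(m, n)) u g : A \in unitmx -> gram A g g = A -> mulmx g @` L = L ->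
  (forall Z, B Z -> B (invmx (ext R g) *m Z)) ->
  is_u A L B X u -> is_u A L B (g *m X) (g *m u).
Proof.
move=> Au gA gL gB [rE uB]; have gu := isometry_unit Au gA; split.
  rewrite span_of_mul radical_mul // -gL; apply/seteqP; split.
    move=> _ [[x rx <-] [y Ly /(can_inj (mulKmx gu)) yx]].
    have [k _ <-] : range (fun k : int => u *~ k) x by rewrite -rE; split; rewrite // -yx.
    by exists k => //; rewrite -!scaler_int scalemxAr.
  move=> _ [k _ <-]; rewrite -scaler_int scalemxAr scaler_int.
  have [] : (radical A (span_of X) `&` L) (u *~ k) by rewrite rE; exists k.
  by split; exists (u *~ k).
move=> Z BZ; rewrite /ext map_mxM -/(ext R g) -/(ext R u).
have gA' : gram (ext R A) (ext R g) (ext R g) = ext R A by rewrite /ext -map_gram gA.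
have gu' : ext R g \in unitmx by rewrite map_unitmx.
rewrite -[Z](mulKVmx gu') bform_isometry //; exact/uB/gB.
Qed.

(** * Behaviour of cosets, orbits and spans under the group *)

Lemma rational_perp_ge0 (R : realType) p (A : 'M[rat]_p.+1) (u z : 'cV[rat]_p.+1) :
  has_signature_p1 (ext R A) -> A^T = A -> u != 0 -> bform A u u = 0 ->
  bform A u z = 0 -> 0 <= bform A z z.
Proof.
move=> sig As u0 uu uz; rewrite -(ler0q R) -(@map_bform _ _ (@ratr R)).
apply: (signature_perp_ge0 (u := ext R u) sig).
- by rewrite /ext map_trmx As.
- by rewrite map_mx_eq0.
- by rewrite map_bform uu rmorph0.
- by rewrite map_bform uz rmorph0.
Qed.

Lemma coset_power_mul m n (A g : 'M[rat]_m) (L : set 'cV[rat]_m) (h X : 'M[rat]_(m, n)) :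
  full_lattice L -> mulmx g @` L = L -> in_power (dual_lattice A L) h ->
  (forall x, dual_lattice A L x -> L (g *m x - x)) ->
  coset_power L h X -> coset_power L h (g *m X).
Proof.
move=> L_lat gL hL gD XL i.
rewrite (_ : g *m X - h = g *m (X - h) + (g *m h - h)); last first.
  by rewrite mulmxBr addrA subrK.
rewrite linearD /=; apply: latticeD => //.
  by rewrite colE -mulmxA -colE -gL; exists (col i (X - h)) => //; exact: XL.
by rewrite linearB /= colE -mulmxA -colE; apply: gD; exact: hL.
Qed.

Lemma same_quotient_orbit_mul m n (G : set 'M[rat]_m) U (X : 'M[rat]_(m, n)) g :
  G 1%:M -> G g -> same_quotient_orbit G U (g *m X) X.
Proof.
move=> G1 Gg; exists ((fun h => g *m h) @` fixing G U); first by exists g.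
exists g => //; exists 1%:M; last by rewrite mulmx1.
by split=> // x _; rewrite mul1mx.
Qed.

(** [g] moves each vector of the span by a multiple of [u], which itself lies in the span. *)
Lemma span_of_fixed m n (A : 'M[rat]_m) u g (X : 'M[rat]_(m, n)) :
  gram A u X = 0 -> span_of X u -> g *m u = u ->
  (forall x, bform A u x = 0 -> exists c, g *m x - x = c *: u) ->
  span_of (g *m X) = span_of X.
Proof.
move=> uX [b _ Xb] gu gp.
have gX c : exists k, g *m (X *m c) = X *m (c + k *: b).
  have [|k kE] := gp (X *m c); first by rewrite /bform gram_mulr uX mul0mx mxE.
  by exists k; rewrite mulmxDr -scalemxAr Xb -kE subrKC.
apply/seteqP; split=> [_ [c _ <-]|_ [c _ <-]].
  by have [k kE] := gX c; exists (c + k *: b) => //; rewrite -mulmxA kE.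
have [k kE] := gX c; exists (c - k *: b) => //.
rewrite mulmxBr -[g *m X *m c]mulmxA kE -scalemxAr -mulmxA Xb gu.
by rewrite mulmxDr -scalemxAr Xb addrK.
Qed.

(** * Invariance, finiteness and representatives for reduced tuples *)

Theorem lemma3p4 (R : realType) (p n : nat) (n_ge1 : (1 <= n)%N)
  (n_le_p : (n <= p)%N)
  (A : 'M[rat]_p.+1) (A_sym : A^T = A) (A_nondeg : A \in unitmx)
  (A_sig : has_signature_p1 (ext R A))
  (A_iso : exists2 x : 'cV[rat]_p.+1, x != 0 & bform A x x = 0)
  (L : set 'cV[rat]_p.+1) (L_lat : full_lattice L)
  (L_dual : L `<=` dual_lattice A L)
  (h : 'M[rat]_(p.+1, n)) (h_dual : in_power (dual_lattice A L) h)
  (B : set 'cV[R]_p.+1) (B_comp : hyperboloid_component A B)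
  (Gamma : set 'M[rat]_p.+1) (Gamma_gp : subgroup Gamma)
  (Gamma_stab : Gamma `<=` lattice_stab R A L)
  (Gamma_index : finite_set (left_cosets (lattice_stab R A L) Gamma))
  (Gamma_neat : neat Gamma)
  (Gamma_disc : forall g x, Gamma g -> dual_lattice A L x -> L (g *m x - x))
  (r : nat) (l : 'I_r.+1 -> set 'cV[rat]_p.+1) (l_inj : injective l)
  (l_reps : represents (same_line_orbit Gamma) (isotropic_line A) (range l))
  (beta : 'M[rat]_n) (beta_sym : beta^T = beta) (beta_psd : psd beta)
  (beta_rank : \rank beta = n.-1)
  (C : 'I_r.+1 -> set 'cV[rat]_p.+1 -> set 'M[rat]_(p.+1, n))
  (C_reps : forall j U, spans_at A L h beta (l j) U ->
     represents (same_quotient_orbit (cusp_group A Gamma (l j)) U)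
       (Omega_span A beta U `&` coset_power L h) (C j U)) :
  let Red := Omega_red A L B beta `&` coset_power L h in
  let Cred := \bigcup_j \bigcup_(U in spans_at A L h beta (l j))
                (C j U `&` Omega_red A L B beta) in
  [/\ forall g X, Gamma g -> Red X -> Red (g *m X),
      finite_set (orbit_of Gamma @` Red) &
      represents (same_orbit Gamma) Red Cred].
Proof.
move=> Red Cred; have [Gu G1 GM GV] := Gamma_gp.
have GA g : Gamma g -> gram A g g = A.
  by move=> /Gamma_stab/lattice_stab_SO[].
have GL g : Gamma g -> mulmx g @` L = L by move=> /Gamma_stab[].
have GLx g x : Gamma g -> L x -> L (g *m x).
  by move=> /GL gL Lx; rewrite -gL; exists x.
have GB g Z : Gamma g -> B Z -> B (invmx (ext R g) *m Z).
  move=> Gg; apply: (SO_id_hyperboloid B_comp); rewrite /ext -map_invmx.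
  by have [] := Gamma_stab _ (GV _ Gg).
have B0 : B !=set0.
  by case: B_comp => Z HZ ->; exists Z; exact: connected_component_refl.
have Gred g X : Gamma g -> Omega_red A L B beta X -> Omega_red A L B beta (g *m X).
  move=> Gg [OX [u [a [nu [uX pa ba Xa nuP]]]]]; split.
    by apply: Omega_s_mul => //; exact: GA.
  exists (g *m u), a, nu; split=> //; last by rewrite -mulmxA Xa scalemxAr.
  by apply: is_u_mul => //; [exact: GA | exact: GL | move=> Z; exact: GB].
have RedM g X : Gamma g -> Red X -> Red (g *m X).
  move=> Gg [RX XL]; split; first exact: Gred.
  apply: coset_power_mul XL => //; first exact: GL.
  by move=> x; exact: Gamma_disc.
have radM g (X : 'M[rat]_(p.+1, n)) : Gamma g ->
    radical A (span_of (g *m X)) = mulmx g @` radical A (span_of X).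
  by move=> Gg; rewrite span_of_mul radical_mul //; exact: GA.
have to_cusp X : Red X -> exists j, exists2 g, Gamma g &
    radical A (span_of (g *m X)) = l j.
  move=> [[OX [u [a [nu [uX pa ba _ _]]]]] _].
  have [_ /(_ (radical A (span_of X)))] := l_reps.
  case=> [|_ [[[j _ <-] [g Gg lg]] _]]; last by exists j, g => //; rewrite radM.
  exists u; split; first exact: (is_u_neq0 A_sym L_lat OX uX pa ba).
    exact: is_u_isotropic uX.
  exact: (is_u_radical A_sym n_ge1 beta_rank L_lat OX uX pa ba).
split=> //.
  (* Each orbit meets the tuples whose radical is some [l j], so finiteness can be checked one cusp
     at a time. *)
  apply: (@sub_finite_set _ _ (\bigcup_(j in [set: 'I_r.+1])
    (orbit_of Gamma @` [set X | Red X /\ radical A (span_of X) = l j]))).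
    move=> _ [X RX <-]; have [j [g Gg lg]] := to_cusp X RX.
    by exists j => //; exists (g *m X); [split; [exact: RedM|] | exact: orbit_of_mul].
  apply: bigcup_finite => [|j _]; first exact: finite_finset.
  have [[X0 [[[OX0 [u [a [nu [uX0 pa ba _ _]]]]] _] rad0]]|noX] :=
    pselect (exists X, Red X /\ radical A (span_of X) = l j); last first.
    by apply: sub_finite_set (finite_set0 _) => Y [X RX _]; case: noX; exists X.
  have u0 := is_u_neq0 A_sym L_lat OX0 uX0 pa ba.
  have uu := is_u_isotropic uX0.
  have [_ Lu] := is_u_mem uX0.
  have [M M0 MG] := eichler_finite_index A_sym A_nondeg L_lat L_dual Lu uu
    Gamma_gp Gamma_index.
  apply: (@finite_cusp_orbits _ _ A u L Gamma h (2 *: beta) a M) => //.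
  - by move=> z; exact: (rational_perp_ge0 A_sig).
  - exact: (is_u_primitive A_sym n_ge1 beta_rank L_lat OX0 uX0 pa ba).
  - exact: primitive_neq0.
  move=> X [[[OX [u1 [a1 [nu1 [uX1 pa1 ba1 Xa1 /andP[nu_ge0 nu_lt1]]]]]] XL] radX].
  have uE : u = u1 by apply: (is_u_unique B0 u0 uX0 uX1); rewrite rad0 radX.
  rewrite -{}uE in uX1 Xa1.
  (* All tuples over [l j] share [u], while their vectors [a1] agree with the fixed [a] up to sign;
     in terms of [a], reducedness leaves the bound [|nu| < 1]. *)
  have [s sE s1] := primitive_kernel_sign n_ge1 beta_rank pa1 pa ba1 ba.
  split=> //; [exact: is_u_gram uX1 | exact: Omega_s_gram | by case: OX |].
  exists (s * nu1); first by rewrite sE -scalemxAr Xa1 scalerA.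
  by rewrite normrM s1 mul1r ger0_norm.
have cusp g X u a : Gamma g -> Omega_s A beta X -> is_u A L B X u ->
    primitive_vec a -> beta *m int_mx a = 0 ->
    radical A (span_of (g *m X)) = radical A (span_of X) ->
    span_of (g *m X) = span_of X /\
    cusp_group A Gamma (radical A (span_of X)) g.
  move=> Gg OX uX pa ba radg.
  have u0 := is_u_neq0 A_sym L_lat OX uX pa ba.
  have uu := is_u_isotropic uX.
  have [[Xu _] _] := is_u_mem uX.
  (* [g u] is the distinguished generator for [g X], whose radical is that of [X], so uniqueness
     applies. *)
  have gu : g *m u = u.
    apply/esym; apply: (is_u_unique B0 u0 uX _ (esym radg)).
    by apply: is_u_mul => //; [exact: GA | exact: GL | move=> Z; exact: GB].
  have gp : forall x, bform A u x = 0 -> exists c, g *m x - x = c *: u.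
    apply: (neat_trivial_perp A_sym A_nondeg u0 uu _ L_lat _ (GA g Gg) Gamma_neat) => //.
      by move=> z; exact: (rational_perp_ge0 A_sig).
    by move=> x; exact: GLx.
  split; first exact: (span_of_fixed (is_u_gram uX)).
  split=> //; rewrite (is_u_radical A_sym n_ge1 beta_rank L_lat OX uX pa ba).
  exists (line_unipotent A u); first exact: line_unipotent_normal.
  by split=> //; exact: lattice_stab_SO (Gamma_stab _ Gg).
have spans_rad j U : spans_at A L h beta (l j) U -> radical A U = l j.
  by move=> [X [_ _ <- ->]].
(* Two members of the chosen sets in one [Gamma]-orbit coincide, even if they are a priori attached
   to different cusps or subspaces. *)
have Cuniq j1 U1 j2 U2 Y g : spans_at A L h beta (l j1) U1 ->
    spans_at A L h beta (l j2) U2 -> C j1 U1 Y -> C j2 U2 (g *m Y) ->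
    Omega_red A L B beta Y -> Gamma g -> Y = g *m Y.
  move=> sU1 sU2 CY CgY [OY [u [a [nu [uY pa ba _ _]]]]] Gg.
  have [[_ spanY] YL] := (C_reps _ _ sU1).1 _ CY.
  have [[_ spangY] _] := (C_reps _ _ sU2).1 _ CgY.
  have rad1 : radical A (span_of Y) = l j1 by rewrite spanY; exact: spans_rad.
  have rad2 : radical A (span_of (g *m Y)) = l j2 by rewrite spangY; exact: spans_rad.
  (* [g] carries [l j1] to [l j2], and the lines [l j] are pairwise inequivalent. *)
  have jj : j1 = j2.
    apply: l_inj; have [lsub lrep] := l_reps.
    have [|y [_ yu]] := lrep (l j2); first by apply: lsub; exists j2.
    transitivity y; [apply/esym|]; apply: yu; (split; first by eexists).
      exists (invmx g); first exact: GV.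
      rewrite -rad2 radM // image_comp rad1 -[LHS]image_id; apply: eq_imagel => x _ /=.
      by rewrite mulKmx //; exact: Gu.
    by exists 1%:M => //; rewrite -[LHS]image_id; apply: eq_imagel => x _; rewrite mul1mx.
  rewrite -{}jj in sU2 CgY rad2 *.
  have radg : radical A (span_of (g *m Y)) = radical A (span_of Y) by rewrite rad1.
  have [spang cg] := cusp g Y u a Gg OY uY pa ba radg.
  have cusp1 : cusp_group A Gamma (l j1) 1%:M.
    by rewrite -rad1; apply: (cusp 1%:M Y u a _ _ _ pa _ _).2; rewrite ?mul1mx.
  rewrite rad1 in cg; have UU : U2 = U1 by rewrite -spangY spang.
  rewrite UU in CgY.
  (* Both [Y] and [g Y] represent the cusp orbit of [Y], so each equals its unique
     representative. *)
  have [|y [_ yu]] := (C_reps _ _ sU1).2 Y; first by split.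
  transitivity y; [apply/esym|]; apply: yu; split=> //.
    by rewrite -{1}[Y]mul1mx; exact: same_quotient_orbit_mul.
  exact: same_quotient_orbit_mul.
split.
  move=> Y [j _ [U sU [CY RY]]]; split=> //.
  by have [_ YL] := (C_reps _ _ sU).1 _ CY.
move=> X RX; have [j [g Gg lg]] := to_cusp X RX.
have [RgX gXL] := RedM g X Gg RX.
have sU : spans_at A L h beta (l j) (span_of (g *m X)).
  by exists (g *m X); split=> //; case: RgX.
(* The representative is [Y = f f' g X] with [f] and [f'] in the cusp group; it is reduced because
   [Gamma] preserves reducedness. *)
have [|Y [[CY [_ [f [Gf _] <-] [_ [f' [[Gf' _] _] <-] YE]]] _]] := (C_reps _ _ sU).2 (g *m X).
  by split=> //; split=> //; case: RgX.
have GY : Gamma (f *m f' *m g) := GM _ _ (GM _ _ Gf Gf') Gg.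
have YX : Y = (f *m f' *m g) *m X by rewrite YE mulmxA.
have RY : Omega_red A L B beta Y by rewrite YX; apply: Gred => //; case: RX.
exists Y; split.
  by split; [exists j => //; exists (span_of (g *m X)) | exists (f *m f' *m g)].
move=> Y' [[j' _ [U' sU' [CY' _]]] [g' Gg' Y'X]].
have Y'Y : Y' = (g' *m invmx (f *m f' *m g)) *m Y.
  by rewrite YX Y'X mulmxA mulmxKV //; exact: Gu.
rewrite Y'Y in CY' *; apply: (Cuniq _ _ _ _ _ _ sU sU' CY CY' RY).
by apply: GM => //; exact: GV.
Qed.
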